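(* Let $f=(f(m,k))\in\prod_{HSG}\mathbb{Z}$. Then $ST(f)$ is summable for any $p>\log 3/\log 2$ if and only if $$\limsup_{m\to\infty}\left(\sum_{k=1}^{3^{m-1}}|f(m,k)|\right)^{1/m}\le 3.$$
   Context: Gasket. Let $\Delta_{0,1}$ be (the boundary curve of) an equilateral triangle in the plane of circumference $2\pi$ with one vertex pointing upwards. The Sierpinski gasket $SG$ is the intersection of the decreasing sequence of compact sets that starts with the solid triangle bounded by $\Delta_{0,1}$ and where at each step, from every remaining solid triangle, the open upside-down middle triangle (with vertices the edge midpoints) is removed. For $m\ge 1$, $\nabla_{m,k}$ $(1\le k\le 3^{m-1})$ are the boundary curves, of circumference $2\pi/2^m$, of the upside-down triangles removed at step $m$. Put $HSG=\{(m,k): m\in\mathbb{N},\ 1\le k\le 3^{m-1}\}$. Modules. For a triangle $T\subset SG$ of circumference $2\pi r$, let $\rho:[-\pi r,\pi r]\to T$ be its closed counterclockwise arc-length parametrization. $UFM(T)$ is the unbounded Fredholm module over $C(SG)$ with Hilbert space $H=L^2([-\pi r,\pi r],\tfrac{dx}{2\pi r})$, representation $\pi(a)\xi(x)=a(\rho(x))\xi(x)$, and Dirac operator $D$ the selfadjoint operator with $D e^{ilx/r}=\tfrac{1}{r}(l+\tfrac12)e^{ilx/r}$, $l\in\mathbb{Z}$ (i.e. $\tfrac1i\tfrac{d}{dx}+\tfrac1{2r}$ with periodic boundary conditions). $\overline{UFM(T)}$ is the same with the orientation of the parametrization reversed. Direct sums. $ZGT:=\overline{UFM(\Delta_{0,1})}\oplus\bigoplus_{m=1}^\infty\bigoplus_{k=1}^{3^{m-1}}UFM(\nabla_{m,k})$.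 For $f\in\prod_{HSG}\mathbb{Z}$, $UFM(f)$ is the direct sum over all $(m,k)\in HSG$ with $f(m,k)\ne0$ of $f(m,k)$ copies of $UFM(\nabla_{m,k})$ if $f(m,k)>0$, and of $-f(m,k)$ copies of $\overline{UFM(\nabla_{m,k})}$ if $f(m,k)<0$. $ST(f):=ZGT\oplus UFM(f)$. With $D_f$ the Dirac operator of $ST(f)$, $ST(f)$ is summable for $p$ if $\mathrm{Tr}((I+D_f^2)^{-p/2})<\infty$. *)

(* Defs.v *)
From HB Require Import structures.
From mathcomp Require Import all_boot all_order all_algebra.
From mathcomp Require Import all_classical all_reals all_analysis.
From mathcomp Require Import complex.

Set Implicit Arguments.
Unset Strict Implicit.
Unset Printing Implicit Defensive.

Import Order.TTheory GRing.Theory Num.Theory numFieldNormedType.Exports.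

Local Open Scope classical_set_scope.
Local Open Scope ring_scope.
Local Open Scope complex_scope.

Section DependentProduct.
Context (K : pzRingType) (I : Type) (V : I -> lmodType K).

Definition dprod := forall i, V i.

HB.instance Definition _ := Choice.copy dprod (forall i, V i).

Implicit Types x y z : dprod.

Let add x y : dprod := fun i => x i + y i.
Let opp x : dprod := fun i => - x i.
Let scale a x : dprod := fun i => a *: x i.

Let addA : associative add.
Proof. by move=> x y z; apply: functional_extensionality_dep => i; exact: addrA. Qed.

Let addC : commutative add.
Proof. by move=> x y; apply: functional_extensionality_dep => i; exact: addrC. Qed.

Let add0 : left_id (fun=> 0) add.
Proof. by move=> x; apply: functional_extensionality_dep => i; exact: add0r. Qed.

Let addN : left_inverse (fun=> 0) opp add.
Proof. by move=> x; apply: functional_extensionality_dep => i; exact: addNr. Qed.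

HB.instance Definition _ := @GRing.isZmodule.Build dprod _ _ _ addA addC add0 addN.

Let scaleA a b x : scale a (scale b x) = scale (a * b) x.
Proof. by apply: functional_extensionality_dep => i; exact: scalerA. Qed.

Let scale1 : left_id 1 scale.
Proof. by move=> x; apply: functional_extensionality_dep => i; exact: scale1r. Qed.

Let scaleDr : right_distributive scale +%R.
Proof. by move=> a x y; apply: functional_extensionality_dep => i; exact: scalerDr. Qed.

Let scaleDl x : {morph scale^~ x : a b / a + b}.
Proof. by move=> a b; apply: functional_extensionality_dep => i; exact: scalerDl. Qed.

HB.instance Definition _ :=
  @GRing.Zmodule_isLmodule.Build K dprod scale scaleA scale1 scaleDr scaleDl.

End DependentProduct.

(* A Hilbert space is given by representatives: its elements are the members of
   [hin], two of them being identified when [heq] holds (for L^2: equality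
   almost everywhere).  [hdot] is linear in its first argument. *)
Record hilbert (R : realType) := Hilbert {
  hvec :> lmodType R[i] ;
  hin : set hvec ;
  hdot : hvec -> hvec -> R[i] }.

Section HilbertSpace.
Context {R : realType} {H : hilbert R}.
Implicit Types (x y u : H) (T : H -> H).

Definition hnorm x : R := Num.sqrt (complex.Re (hdot x x)).

Definition heq x y : Prop := hnorm (x - y) = 0.

Definition orthonormal (J : choiceType) (b : J -> H) : Prop :=
  (forall j, hin (b j)) /\ (forall i j, hdot (b i) (b j) = (i == j)%:R).

Definition orthonormal_basis (J : choiceType) (b : J -> H) : Prop :=
  orthonormal b /\
  forall x, hin x -> forall eps : R, 0 < eps ->
    exists (s : seq J) (c : J -> R[i]),
      hnorm (x - \sum_(j <- s) c j *: b j) < eps.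

Definition bounded_operator T : Prop :=
  [/\ forall x, hin x -> hin (T x),
      forall a x y, hin x -> hin y -> heq (T (a *: x + y)) (a *: T x + T y)
    & exists C : R, forall x, hin x -> hnorm (T x) <= C * hnorm x].

(* T = g(D) for a selfadjoint D (given by its graph) having an orthonormal
   basis of eigenvectors: a bounded operator is determined by its values on
   the basis. *)
Definition functional_calculus (D : H -> H -> Prop) (g : R -> R) T : Prop :=
  bounded_operator T /\
  exists (J : choiceType) (b : J -> H) (lam : J -> R),
    [/\ orthonormal_basis b,
        forall j, D (b j) ((lam j)%:C *: b j)
      & forall j, heq (T (b j)) ((g (lam j))%:C *: b j)].

(* The trace of a positive operator is the sum of the <T b_j, b_j> over an
   orthonormal basis, whose choice is irrelevant. *)
Definition finite_trace T : Prop :=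
  exists (J : choiceType) (b : J -> H),
    orthonormal_basis b /\
    (\esum_(j in [set: J]) (complex.Re (hdot (T (b j)) (b j)))%:E < +oo)%E.

End HilbertSpace.

Section Sums.
Context {R : realType} {I : choiceType}.

Definition rsum (u : I -> R) : R :=
  let U := EFin \o u in
  fine (\esum_(i in [set: I]) U^\+ i)%E - fine (\esum_(i in [set: I]) U^\- i)%E.

Definition csum (u : I -> R[i]) : R[i] :=
  rsum (fun i => complex.Re (u i)) +i* rsum (fun i => complex.Im (u i)).

Definition hsum (H : I -> hilbert R) : hilbert R :=
  @Hilbert R (dprod (fun i => hvec (H i)))
    [set x | (forall i, hin (x i)) /\
             (\esum_(i in [set: I]) (hnorm (x i) ^+ 2)%:E < +oo)%E]
    (fun x y => csum (fun i => hdot (x i) (y i))).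

End Sums.

Section Gasket.
Context (R : realType).

Definition plane : Type := (R * R)%type.

(* Affine coordinates in the upright equilateral triangle with lower left
   vertex p and side s: the vertices are (0,0), (1,0) and (0,1). *)
Definition tri_point (p : plane) (s u v : R) : plane :=
  (p.1 + s * (u + v / 2), p.2 + s * (v * (Num.sqrt 3 / 2))).

Definition solid (p : plane) (s : R) : set plane :=
  [set q | exists u v, [/\ 0 <= u, 0 <= v, u + v <= 1 & q = tri_point p s u v]].

Definition hole (p : plane) (s : R) : set plane :=
  [set q | exists u v,
     [/\ u < 1 / 2, v < 1 / 2, 1 / 2 < u + v & q = tri_point p s u v]].

Definition side (n : nat) : R := 2 * pi / 3 / 2 ^+ n.

(* Lower left vertices of the 3^n solid triangles remaining after n steps: the
   base 3 digits of k < 3^n record the successive choices of a corner. *)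
Fixpoint corner (n k : nat) : plane :=
  if n is n'.+1 then
    tri_point (corner n' (k %/ 3)) (side n)
      (k %% 3 == 1)%N%:R (k %% 3 == 2)%N%:R
  else (0, 0).

Fixpoint remaining (n : nat) : set plane :=
  if n is n'.+1 then
    remaining n' `\` \bigcup_(k in [set k | (k < 3 ^ n')%N])
                        hole (corner n' k) (side n')
  else solid (corner 0 0) (side 0).

Definition SG : set plane := \bigcap_n remaining n.

(* The values of [cfun] off SG are irrelevant. *)
Record CSG := MkCSG {
  cfun :> plane -> R[i] ;
  cfun_re : {within SG, continuous (fun q => complex.Re (cfun q))} ;
  cfun_im : {within SG, continuous (fun q => complex.Im (cfun q))} }.

(* The boundary of the triangle with vertices va, vb, vc in counterclockwise
   order and circumference 2 pi r. *)
Record triangle := Triangle { radius : R ; va : plane ; vb : plane ; vc : plane }.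

Definition segment (p q : plane) (t : R) : plane :=
  (p.1 + t * (q.1 - p.1), p.2 + t * (q.2 - p.2)).

Definition rho (T : triangle) (x : R) : plane :=
  let t := (x + pi * radius T) / (2 * pi * radius T / 3) in
  if t <= 1 then segment (va T) (vb T) t
  else if t <= 2 then segment (vb T) (vc T) (t - 1)
  else segment (vc T) (va T) (t - 2).

Definition Delta01 : triangle :=
  let P := tri_point (corner 0 0) (side 0) in Triangle 1 (P 0 0) (P 1 0) (P 0 1).

(* [hsg k] with [k : 'I_(3 ^ m)] stands for the pair (m+1, k+1): numbering from
   0, the triangle removed at step m+1 from the k-th solid triangle of step m. *)
Definition HSG := {m : nat & 'I_(3 ^ m)}.

Definition hsg (m : nat) (k : 'I_(3 ^ m)) : HSG := existT _ m k.

Definition nabla (h : HSG) : triangle :=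
  let P := tri_point (corner (tag h) (tagged h)) (side (tag h)) in
  Triangle (2 ^- (tag h).+1) (P (1 / 2) 0) (P (1 / 2) (1 / 2)) (P 0 (1 / 2)).

End Gasket.

Section Circle.
Context {R : realType}.
Notation mu := (@lebesgue_measure R).

Definition cball (r : R) : set R := `[- (pi * r), pi * r]%classic.

Definition cmean (r : R) (u : R -> R[i]) : R[i] :=
  ((2 * pi * r)^-1 * \int[mu]_(x in cball r) complex.Re (u x)) +i*
  ((2 * pi * r)^-1 * \int[mu]_(x in cball r) complex.Im (u x)).

Definition L2 (r : R) : hilbert R :=
  @Hilbert R (R -> R[i])
    [set x : R -> R[i] |
      [/\ measurable_fun (cball r) (fun t : R => complex.Re (x t) : R),
          measurable_fun (cball r) (fun t : R => complex.Im (x t) : R)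
        & (\int[mu]_(t in cball r)
             (complex.Re (x t) ^+ 2 + complex.Im (x t) ^+ 2)%:E < +oo)%E]]
    (fun x y => cmean r (fun t => x t * (y t)^*)).

Definition fourier (r : R) (l : int) : L2 r :=
  fun x : R => cos (l%:~R * x / r) +i* sin (l%:~R * x / r).

(* The graph of the selfadjoint operator with the eigenvectors [fourier r l]:
   the adjoint of its restriction to their span. *)
Definition circle_dirac (r : R) (x y : L2 r) : Prop :=
  [/\ hin x, hin y &
      forall l : int,
        hdot y (fourier r l) = ((l%:~R + 1 / 2) / r)%:C * hdot x (fourier r l)].

End Circle.

(* The data of an unbounded Fredholm module over C(SG); the Dirac operator is
   given by its graph. *)
Record ufmodule (R : realType) := UFModule {
  hspace :> hilbert R ;
  representation : CSG R -> hspace -> hspace ;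
  dirac : hspace -> hspace -> Prop }.

Section Modules.
Context {R : realType}.

Definition curve_module (r : R) (c : R -> plane R) : ufmodule R :=
  @UFModule R (L2 r)
    (fun (a : CSG R) (x : R -> R[i]) => (fun t => a (c t) * x t) : R -> R[i])
    (@circle_dirac R r).

Definition UFM (T : triangle R) : ufmodule R := curve_module (radius T) (rho T).

Definition UFM_bar (T : triangle R) : ufmodule R :=
  curve_module (radius T) (fun t => rho T (- t)).

Definition dirsum (I : choiceType) (M : I -> ufmodule R) : ufmodule R :=
  @UFModule R (hsum (fun i => hspace (M i)))
    (fun a x i => representation a (x i))
    (fun x y => [/\ @hin R (hsum (fun i => hspace (M i))) x,
                    @hin R (hsum (fun i => hspace (M i))) y
                  & forall i, dirac (x i) (y i)]).

Definition dirsum2 (M N : ufmodule R) : ufmodule R :=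
  dirsum (fun b : bool => if b then M else N).

Definition summable_for (M : ufmodule R) (p : R) : Prop :=
  exists T : M -> M,
    functional_calculus (@dirac R M) (fun l => (1 + l ^+ 2) `^ (- (p / 2))) T
    /\ finite_trace T.

End Modules.

Section SierpinskiModules.
Context (R : realType).

Definition ZGT : ufmodule R :=
  dirsum2 (UFM_bar (Delta01 R)) (dirsum (fun h : HSG => UFM (nabla R h))).

Definition UFM_mult (f : HSG -> int) : ufmodule R :=
  dirsum (fun c : {h : HSG & 'I_(absz (f h))} =>
    if 0 < f (tag c) then UFM (nabla R (tag c)) else UFM_bar (nabla R (tag c))).

Definition ST (f : HSG -> int) : ufmodule R := dirsum2 ZGT (UFM_mult f).

End SierpinskiModules.

(* Main.v *)
Require Import Defs.
From HB Require Import structures.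
From mathcomp Require Import all_boot all_order all_algebra.
From mathcomp Require Import all_classical all_reals all_analysis.
From mathcomp Require Import measurable_realfun complex ring lra.

(* Each circle module has the trigonometric functions as an eigenbasis of its
   Dirac operator, so the trace of [(1 + D^2)^(-p/2)] over a circle of radius [r]
   is comparable to [r^p] once [p > 3/2].  Hence [ST f] is summable for [p] iff
   the sum over [m] of [2^(-mp) (3^m + F m)] is finite, where [F m] is the number
   of copies at level [m]; for all [p > log 3 / log 2] at once this says that
   [F m] grows at most like [3^m].

   For sufficiency the operator [(1 + D^2)^(-p/2)] is constructed summand by summand as
   an absolutely convergent Fourier multiplier, and the trigonometric system is
   shown to be complete in [L^2].  For necessity neither completeness nor the shape of
   the given eigenbasis is used: for any orthonormal family of weak eigenvectors
   of [D], Bessel's inequality for the square root of the operator bounds the sum of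
   the corresponding eigenvalues by the trace in any given basis. *)

(* [orthonormal] is also a notion of MathComp. *)
Import Defs.

Set Implicit Arguments.
Unset Strict Implicit.
Unset Printing Implicit Defensive.

Import Order.TTheory GRing.Theory Num.Theory numFieldNormedType.Exports.

Local Open Scope classical_set_scope.
Local Open Scope ring_scope.
Local Open Scope complex_scope.

Local Notation Re := complex.Re.
Local Notation Im := complex.Im.

(** * Pre-Hilbert spaces *)

(** The threshold 3/2 comes from 8 < 9, that is 3/2 < log 3 / log 2: the trace over one circle is
    compared with the series of (n+1)^(-3/2), whose partial sums telescope to an explicit bound.
    Summability of the eigenvalues of the operator also lets its values be written down point by
    point, and the resulting operator bound is uniform over all radius at most 1, as boundedness on
    an infinite direct sum requires.

    For necessity the obstacle is that [summable_for] supplies two unrelated bases, one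
    diagonalising D and one computing the trace, and neither has to respect the decomposition into
    circles. The known eigenvectors are compared with each of them separately: a given eigenvector
    of D with another eigenvalue is orthogonal to them, and in the trace basis Parseval's inequality
    applies to them. One eigenvector per copy is enough, the constant function, whose eigenvalue is
    2^m at index m of the code. Choosing p with 2^p = y, for arbitrary y > 3, then bounds the number
    of copies by a constant times y^m. *)

Section ComplexParts.
Context {R : rcfType}.
Implicit Types (z w : R[i]) (a : R).

Lemma Re_add z w : Re (z + w) = Re z + Re w.
Proof. by case: z; case: w. Qed.
Lemma Im_add z w : Im (z + w) = Im z + Im w.
Proof. by case: z; case: w. Qed.
Lemma Re_opp z : Re (- z) = - Re z.
Proof. by case: z. Qed.
Lemma Im_opp z : Im (- z) = - Im z.
Proof. by case: z. Qed.
Lemma Re_mul z w : Re (z * w) = Re z * Re w - Im z * Im w.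
Proof. by case: z; case: w. Qed.
Lemma Im_mul z w : Im (z * w) = Re z * Im w + Im z * Re w.
Proof. by case: z; case: w. Qed.
Lemma Re_conjc z : Re (conjc z) = Re z.
Proof. by case: z. Qed.
Lemma Im_conjc z : Im (conjc z) = - Im z.
Proof. by case: z. Qed.
Definition ReImE := (Re_add, Im_add, Re_opp, Im_opp, Re_mul, Im_mul, Re_conjc, Im_conjc).

Lemma complex_eqP z w : Re z = Re w -> Im z = Im w -> z = w.
Proof. by case: z => a b; case: w => c d /= -> ->. Qed.

Lemma Re_sum I (s : seq I) (F : I -> R[i]) :
  Re (\sum_(i <- s) F i) = \sum_(i <- s) Re (F i).
Proof. by elim/big_ind2: _ => // a b c d <- <-; rewrite Re_add. Qed.

Lemma conjcD z w : conjc (z + w) = conjc z + conjc w.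
Proof. by apply: complex_eqP; rewrite !ReImE //; ring. Qed.
Lemma conjcM z w : conjc (z * w) = conjc z * conjc w.
Proof. by apply: complex_eqP; rewrite !ReImE //; ring. Qed.
Lemma conjc_sum I (s : seq I) (F : I -> R[i]) :
  conjc (\sum_(i <- s) F i) = \sum_(i <- s) conjc (F i).
Proof. by elim/big_ind2: _ => [|a b c d <- <-|//]; [rewrite conjc0|rewrite conjcD]. Qed.

(** The squared modulus is kept in [R], where it can be compared directly with squares of
    [hnorm]. *)
Definition nsq z : R := Re z ^+ 2 + Im z ^+ 2.

Lemma nsq_ge0 z : 0 <= nsq z.
Proof. by rewrite addr_ge0 ?sqr_ge0. Qed.
Lemma nsqM z w : nsq (z * w) = nsq z * nsq w.
Proof. by rewrite /nsq !ReImE; ring. Qed.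
Lemma nsqJ z : nsq (conjc z) = nsq z.
Proof. by rewrite /nsq !ReImE sqrrN. Qed.
Lemma nsqR a : nsq a%:C = a ^+ 2.
Proof. by rewrite /nsq /= expr0n addr0. Qed.
Lemma mul_conj z : z * conjc z = (nsq z)%:C.
Proof. by apply: complex_eqP; rewrite /nsq !ReImE /=; ring. Qed.
Lemma nsq_eq0 z : nsq z = 0 -> z = 0.
Proof.
move/eqP; rewrite paddr_eq0 ?sqr_ge0 // !sqrf_eq0 => /andP[/eqP a0 /eqP b0].
exact: complex_eqP.
Qed.
Lemma sqr_Re_le z : Re z ^+ 2 <= nsq z.
Proof. by rewrite lerDl sqr_ge0. Qed.
Lemma sqr_Im_le z : Im z ^+ 2 <= nsq z.
Proof. by rewrite lerDr sqr_ge0. Qed.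

End ComplexParts.

(* The record [hilbert] carries no axioms. *)
Record prehilbert (R : realType) (H : hilbert R) : Prop := Prehilbert {
  hin0 : @hin R H 0 ;
  hin_lin : forall a (x y : H), hin x -> hin y -> hin (a *: x + y) ;
  hdot_lin : forall a (x y z : H), hin x -> hin y -> hin z ->
    hdot (a *: x + y) z = a * hdot x z + hdot y z ;
  hdotC : forall x y : H, hin x -> hin y -> hdot y x = conjc (hdot x y) ;
  hdot_ge0 : forall x : H, hin x -> 0 <= Re (hdot x x) }.

Section PrehilbertTheory.
Context {R : realType} {H : hilbert R} (preH : prehilbert H).
Implicit Types (x y z : H).

Lemma hinZ a x : hin x -> hin (a *: x).
Proof. by move=> hx; rewrite -[_ *: _]addr0; apply: (hin_lin preH) => //; exact: hin0. Qed.

Lemma hinD x y : hin x -> hin y -> hin (x + y).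
Proof. by move=> hx hy; rewrite -[x]scale1r; exact: hin_lin. Qed.

Lemma hinN x : hin x -> hin (- x).
Proof. by rewrite -scaleN1r; exact: hinZ. Qed.

Lemma hinB x y : hin x -> hin y -> hin (x - y).
Proof. by move=> hx /hinN; exact: hinD. Qed.

Lemma hin_sum I (s : seq I) (F : I -> H) :
  (forall i, hin (F i)) -> hin (\sum_(i <- s) F i).
Proof. by move=> hF; elim/big_ind: _ => //; [exact: hin0 | exact: hinD]. Qed.

Lemma hdot0l z : hin z -> hdot (0 : H) z = 0.
Proof.
move=> hz; have h0 := hin0 preH.
have := hdot_lin preH (- 1) h0 h0 hz.
by rewrite scaler0 addr0 mulN1r addNr.
Qed.

Lemma hdotZl a x z : hin x -> hin z -> hdot (a *: x) z = a * hdot x z.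
Proof.
move=> hx hz; have := hdot_lin preH a hx (hin0 preH) hz.
by rewrite addr0 hdot0l // addr0.
Qed.

Lemma hdotDl x y z : hin x -> hin y -> hin z ->
  hdot (x + y) z = hdot x z + hdot y z.
Proof. by move=> hx hy hz; have := hdot_lin preH 1 hx hy hz; rewrite scale1r mul1r. Qed.

Lemma hdotNl x z : hin x -> hin z -> hdot (- x) z = - hdot x z.
Proof. by move=> hx hz; rewrite -scaleN1r hdotZl // mulN1r. Qed.

Lemma hdotBl x y z : hin x -> hin y -> hin z ->
  hdot (x - y) z = hdot x z - hdot y z.
Proof. by move=> hx hy hz; rewrite hdotDl ?hdotNl //; exact: hinN. Qed.

Lemma hdotZr a x z : hin x -> hin z -> hdot z (a *: x) = conjc a * hdot z x.
Proof.
move=> hx hz; rewrite (hdotC preH (hinZ a hx) hz) hdotZl // conjcM.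
by rewrite -(hdotC preH hx hz).
Qed.

Lemma hdotDr x y z : hin x -> hin y -> hin z ->
  hdot z (x + y) = hdot z x + hdot z y.
Proof.
move=> hx hy hz; rewrite (hdotC preH (hinD hx hy) hz) hdotDl // conjcD.
by rewrite -(hdotC preH hx hz) -(hdotC preH hy hz).
Qed.

Lemma hdotNr x z : hin x -> hin z -> hdot z (- x) = - hdot z x.
Proof.
move=> hx hz; rewrite -scaleN1r hdotZr //.
by apply: complex_eqP; rewrite !ReImE /=; ring.
Qed.

Lemma hdotBr x y z : hin x -> hin y -> hin z ->
  hdot z (x - y) = hdot z x - hdot z y.
Proof. by move=> hx hy hz; rewrite hdotDr ?hdotNr //; exact: hinN. Qed.

Lemma hdot_suml I (s : seq I) (F : I -> H) z :
  (forall i, hin (F i)) -> hin z ->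
  hdot (\sum_(i <- s) F i) z = \sum_(i <- s) hdot (F i) z.
Proof.
move=> hF hz; elim: s => [|i s IH]; first by rewrite !big_nil hdot0l.
by rewrite !big_cons hdotDl ?IH //; exact: hin_sum.
Qed.

Lemma hdot_sumr I (s : seq I) (F : I -> H) z :
  (forall i, hin (F i)) -> hin z ->
  hdot z (\sum_(i <- s) F i) = \sum_(i <- s) hdot z (F i).
Proof.
move=> hF hz; rewrite (hdotC preH (hin_sum s hF) hz) hdot_suml // conjc_sum.
by apply: eq_bigr => i _; rewrite -(hdotC preH (hF i) hz).
Qed.

Lemma Im_hdotxx x : hin x -> Im (hdot x x) = 0.
Proof.
move=> hx; have := congr1 (@complex.Im R) (hdotC preH hx hx).
by rewrite Im_conjc; lra.
Qed.

Lemma sqr_hnorm x : hin x -> hnorm x ^+ 2 = Re (hdot x x).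
Proof. by move=> hx; rewrite sqr_sqrtr // hdot_ge0. Qed.

Lemma hdotxx x : hin x -> hdot x x = (hnorm x ^+ 2)%:C.
Proof. by move=> hx; apply: complex_eqP; rewrite /= ?sqr_hnorm ?Im_hdotxx. Qed.

Lemma hnorm_ge0 x : 0 <= hnorm x.
Proof. exact: sqrtr_ge0. Qed.

Lemma hnorm0 : hnorm (0 : H) = 0.
Proof. by rewrite /hnorm hdot0l ?sqrtr0 //; exact: hin0. Qed.

Lemma heq_refl x : heq x x.
Proof. by rewrite /heq subrr hnorm0. Qed.

(** Expand ‖x - t c y‖² >= 0 for real t, with c the inner product. If ‖y‖ is nonzero, take t =
    ‖y‖⁻². A vector y of norm 0 need not be 0; then the expansion is affine in t, and if c were
    nonzero a suitable t would give it the value -1. *)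
Lemma cauchy_schwarz x y : hin x -> hin y ->
  nsq (hdot x y) <= hnorm x ^+ 2 * hnorm y ^+ 2.
Proof.
move=> hx hy; set c := hdot x y.
have key (t : R) : 0 <= hnorm x ^+ 2 - 2 * t * nsq c + t ^+ 2 * nsq c * hnorm y ^+ 2.
  set a := (- t)%:C * c.
  have hay := hinZ a hy.
  have := sqr_ge0 (hnorm (x + a *: y)).
  rewrite (sqr_hnorm (hinD hx hay)).
  rewrite hdotDl ?hdotDr ?hdotZr ?hdotZl ?hdotxx //; try exact: hinD.
  rewrite (hdotC preH hx hy) -/c /a /nsq !ReImE /=.
  by move/le_trans; apply; rewrite le_eqVlt; apply/orP; left; apply/eqP; ring.
have n0 := nsq_ge0 c.
have [y0|y0] := eqVneq (hnorm y) 0.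
  rewrite y0 expr0n mulr0; have [//|c0] := leP.
  have := key ((hnorm x ^+ 2 + 1) / (2 * nsq c)).
  rewrite y0 expr0n mulr0 addr0.
  have -> : 2 * ((hnorm x ^+ 2 + 1) / (2 * nsq c)) * nsq c = hnorm x ^+ 2 + 1.
    by field; rewrite gt_eqF.
  lra.
have y2 : 0 < hnorm y ^+ 2 by rewrite exprn_gt0 // lt_def y0 hnorm_ge0.
have := key (hnorm y ^- 2).
have -> : hnorm x ^+ 2 - 2 * hnorm y ^- 2 * nsq c
    + hnorm y ^- 2 ^+ 2 * nsq c * hnorm y ^+ 2
    = hnorm x ^+ 2 - nsq c / hnorm y ^+ 2 by field.
by rewrite subr_ge0 ler_pdivrMr.
Qed.

Lemma abs_Re_hdot_le x y : hin x -> hin y -> `|Re (hdot x y)| <= hnorm x * hnorm y.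
Proof.
move=> hx hy; rewrite -(@ler_pXn2r _ 2%N) ?nnegrE ?mulr_ge0 ?hnorm_ge0 //.
rewrite -normrX ger0_norm ?sqr_ge0 // exprMn.
exact: le_trans (sqr_Re_le _) (cauchy_schwarz _ _).
Qed.

Lemma abs_Im_hdot_le x y : hin x -> hin y -> `|Im (hdot x y)| <= hnorm x * hnorm y.
Proof.
move=> hx hy; rewrite -(@ler_pXn2r _ 2%N) ?nnegrE ?mulr_ge0 ?hnorm_ge0 //.
rewrite -normrX ger0_norm ?sqr_ge0 // exprMn.
exact: le_trans (sqr_Im_le _) (cauchy_schwarz _ _).
Qed.

Lemma sqr_hnormD x y : hin x -> hin y ->
  hnorm (x + y) ^+ 2 = hnorm x ^+ 2 + hnorm y ^+ 2 + 2 * Re (hdot x y).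
Proof.
move=> hx hy; rewrite !sqr_hnorm ?hdotDl ?hdotDr //; try exact: hinD.
by rewrite (hdotC preH hx hy) !ReImE; ring.
Qed.

Lemma hnormD x y : hin x -> hin y -> hnorm (x + y) <= hnorm x + hnorm y.
Proof.
move=> hx hy; rewrite -(@ler_pXn2r _ 2%N) ?nnegrE ?addr_ge0 ?hnorm_ge0 //.
rewrite sqr_hnormD // sqrrD.
have := abs_Re_hdot_le hx hy; rewrite ler_norml => /andP[_].
rewrite -mulr_natr; lra.
Qed.

Lemma hnormZ a x : hin x -> hnorm (a *: x) = Num.sqrt (nsq a) * hnorm x.
Proof.
move=> hx; rewrite /hnorm (hdotZl _ hx (hinZ a hx)) (hdotZr _ hx hx).
rewrite mulrA mul_conj hdotxx // -rmorphM /= sqrtrM ?nsq_ge0 //.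
Qed.

Lemma hnormN x : hin x -> hnorm (- x) = hnorm x.
Proof.
by move=> hx; rewrite -scaleN1r hnormZ // /nsq /= oppr0 sqrrN expr1n expr0n addr0 sqrtr1 mul1r.
Qed.

Lemma hnormB x y : hin x -> hin y -> hnorm (x - y) <= hnorm x + hnorm y.
Proof. by move=> hx hy; rewrite -(hnormN hy); apply: hnormD => //; exact: hinN. Qed.

Lemma hnorm_subC x y : hin x -> hin y -> hnorm (x - y) = hnorm (y - x).
Proof. by move=> hx hy; rewrite -hnormN ?opprB //; exact: hinB. Qed.

(** With Cauchy-Schwarz the inner product depends only on classes modulo [heq], although the vectors
    are representatives and no quotient is formed. *)
Lemma hdot_null x z : hin x -> hin z -> hnorm x = 0 -> hdot x z = 0.
Proof.
move=> hx hz x0; apply: nsq_eq0; apply/eqP; rewrite eq_le nsq_ge0 andbT.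
by apply: le_trans (cauchy_schwarz hx hz) _; rewrite x0 expr0n mul0r.
Qed.

Lemma heq_hdotl x y z : hin x -> hin y -> hin z -> heq x y -> hdot x z = hdot y z.
Proof.
move=> hx hy hz xy; apply/eqP; rewrite -subr_eq0 -hdotBl //.
by rewrite hdot_null //; exact: hinB.
Qed.

Lemma heq_trans x y z : hin x -> hin y -> hin z -> heq x y -> heq y z -> heq x z.
Proof.
move=> hx hy hz xy yz; apply/eqP; rewrite eq_le hnorm_ge0 andbT.
rewrite -[x - z](subrKA y); apply: le_trans (hnormD _ _) _; try exact: hinB.
by rewrite xy yz addr0.
Qed.

Lemma heq_lin a x y x' y' : hin x -> hin y -> hin x' -> hin y' ->
  heq x x' -> heq y y' -> heq (a *: x + y) (a *: x' + y').
Proof.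
move=> hx hy hx' hy' xx yy; rewrite /heq opprD addrACA -scalerBr.
apply/eqP; rewrite eq_le hnorm_ge0 andbT.
have hxx := hinB hx hx'.
apply: le_trans (hnormD (hinZ a hxx) (hinB hy hy')) _.
by rewrite hnormZ // xx yy mulr0 addr0.
Qed.

End PrehilbertTheory.

(** * Orthonormal families and the trace *)

(** Polarisation: |u|² - |v|² is the real part of (u - v) times the conjugate of u + v. It measures
    how much a squared coefficient moves when its vector is approximated. *)
Lemma nsq_le_add (R : rcfType) (u v : R[i]) (a c : R) : 0 <= a -> 0 <= c ->
  nsq (u - v) <= a ^+ 2 -> nsq (u + v) <= c ^+ 2 -> nsq u <= nsq v + a * c.
Proof.
move=> a0 c0 ua vc; rewrite -lerBlDl.
have -> : nsq u - nsq v = Re ((u - v) * conjc (u + v)) by rewrite /nsq !ReImE; ring.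
apply: le_trans (ler_norm _) _.
rewrite -(@ler_pXn2r _ 2%N) ?nnegrE ?mulr_ge0 // -normrX ger0_norm ?sqr_ge0 //.
by apply: le_trans (sqr_Re_le _) _; rewrite nsqM nsqJ exprMn ler_pM ?nsq_ge0.
Qed.

(** The inequality <= holds for every nonnegative factor; applied to c⁻¹ and the family c a it gives
    the reverse one. *)
Lemma esumZl (R : realType) (I : choiceType) (c : R) (a : I -> R) : 0 <= c ->
  (forall i, 0 <= a i) ->
  (\esum_(i in [set: I]) (c * a i)%:E = c%:E * \esum_(i in [set: I]) (a i)%:E)%E.
Proof.
have le (k : R) (u : I -> R) : 0 <= k -> (forall i, 0 <= u i) ->
    (\esum_(i in [set: I]) (k * u i)%:E <= k%:E * \esum_(i in [set: I]) (u i)%:E)%E.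
  move=> k0 u0; apply: ge_ereal_sup => _ [X [finX _] <-].
  under eq_fsbigr do rewrite EFinM.
  rewrite -ge0_mule_fsumr; last by move=> i; rewrite lee_fin.
  by apply: lee_wpmul2l; rewrite ?lee_fin //; apply: esum_ge; exists X.
move=> c0 a0; have [->|cn0] := eqVneq c 0.
  by rewrite mul0e esum1 // => i _; rewrite mul0r.
have c0' : 0 < c by rewrite lt_def cn0.
apply/eqP; rewrite eq_le le //=.
have := le c^-1 (fun i => c * a i); rewrite invr_ge0 => /(_ c0).
under eq_esum do rewrite mulKf //.
move=> /(_ (fun i => mulr_ge0 c0 (a0 i))) h.
apply: le_trans (lee_wpmul2l _ h) _; first by rewrite lee_fin.
by rewrite muleA -EFinM divff // mul1e.
Qed.

Section Orthonormal.
Context {R : realType} {H : hilbert R} (preH : prehilbert H).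
Context {J : choiceType} {b : J -> H} (ob : orthonormal b).
Implicit Types (x y z : H) (s : seq J) (c : J -> R[i]).

Let hb j : hin (b j). Proof. exact: ob.1. Qed.

Lemma hin_comb s c : hin (\sum_(j <- s) c j *: b j).
Proof. by apply: hin_sum => // j; exact: hinZ. Qed.

Lemma hdot_comb x s c : hin x ->
  hdot x (\sum_(j <- s) c j *: b j) = \sum_(j <- s) conjc (c j) * hdot x (b j).
Proof.
move=> hx; rewrite (hdot_sumr preH) //; last by move=> j; exact: hinZ.
by apply: eq_bigr => j _; rewrite (hdotZr preH).
Qed.

Lemma comb_hdot y s c : hin y ->
  hdot (\sum_(j <- s) c j *: b j) y = \sum_(j <- s) c j * hdot (b j) y.
Proof.
move=> hy; rewrite (hdot_suml preH) //; last by move=> j; exact: hinZ.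
by apply: eq_bigr => j _; rewrite (hdotZl preH).
Qed.

Lemma comb_hdot_comb s c c' : uniq s ->
  hdot (\sum_(j <- s) c j *: b j) (\sum_(j <- s) c' j *: b j)
  = \sum_(j <- s) c j * conjc (c' j).
Proof.
move=> us; rewrite comb_hdot; last exact: hin_comb.
rewrite [LHS]big_seq [RHS]big_seq; apply: eq_bigr => j js; congr (_ * _).
rewrite hdot_comb // (bigD1_seq j) //= big1 => [|i /negPf ij].
  by rewrite ob.2 eqxx mulr1 addr0.
by rewrite ob.2 eq_sym ij mulr0.
Qed.

Lemma sqr_hnorm_comb s c : uniq s ->
  hnorm (\sum_(j <- s) c j *: b j) ^+ 2 = \sum_(j <- s) nsq (c j).
Proof.
move=> us; rewrite (sqr_hnorm preH (hin_comb _ _)) comb_hdot_comb // Re_sum.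
by apply: eq_bigr => j _; rewrite mul_conj.
Qed.

(** Completing the square separates the part that depends on the coefficients from the Bessel
    defect. Choosing the Fourier coefficients yields Bessel's inequality, and dropping the last sum
    yields Parseval's. *)
Lemma sqr_hnorm_sub_comb x s c : hin x -> uniq s ->
  hnorm (x - \sum_(j <- s) c j *: b j) ^+ 2 =
  hnorm x ^+ 2 - \sum_(j <- s) nsq (hdot x (b j))
  + \sum_(j <- s) nsq (c j - hdot x (b j)).
Proof.
move=> hx us; have hS := hin_comb s c.
rewrite (sqr_hnormD preH hx (hinN preH hS)) (hdotNr preH hS hx).
rewrite (hnormN preH hS) sqr_hnorm_comb // hdot_comb // Re_opp Re_sum.
rewrite -!addrA; congr (_ + _); rewrite mulrN mulr_sumr -!sumrB -sumrN -big_split /=.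
by apply: eq_bigr => j _; rewrite /nsq !ReImE; ring.
Qed.

Lemma bessel x s : hin x -> uniq s ->
  \sum_(j <- s) nsq (hdot x (b j)) <= hnorm x ^+ 2.
Proof.
move=> hx us; rewrite -subr_ge0.
have := sqr_hnorm_sub_comb (fun j => hdot x (b j)) hx us.
rewrite [\sum_(j <- s) nsq (_ - _)]big1 => [|j _]; last by rewrite subrr /nsq /= expr0n addr0.
by rewrite addr0 => <-; exact: sqr_ge0.
Qed.

(** The density condition in [orthonormal_basis] admits lists with repetitions, while the norm
    formulas need [uniq]: a repeated index is absorbed by multiplying its coefficient by its
    multiplicity. *)
Lemma comb_undup s c : exists c' : J -> R[i],
  \sum_(j <- s) c j *: b j = \sum_(j <- undup s) c' j *: b j.
Proof.
exists (fun j => c j *+ count_mem j s).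
rewrite -big_undup_iterop_count /=; apply: eq_bigr => j _.
by rewrite -scalerMnl.
Qed.

End Orthonormal.

Section OrthonormalBasis.
Context {R : realType} {H : hilbert R} (preH : prehilbert H).
Context {J : choiceType} {b : J -> H} (bb : orthonormal_basis b).
Implicit Types (x y z : H).

Lemma basis_uniq x e : hin x -> 0 < e -> exists (s : seq J) (c : J -> R[i]),
  uniq s /\ hnorm (x - \sum_(j <- s) c j *: b j) < e.
Proof.
move=> hx e0; have [s [c sc]] := bb.2 _ hx _ e0.
by have [c' cc'] := comb_undup (b := b) s c; exists (undup s), c'; rewrite undup_uniq -cc'.
Qed.

(** The Bessel defect of x over a finite list is at most the squared distance from x to any
    combination over that list, and density makes this distance smaller than the square root of any
    given e. *)
Lemma parseval_le x : hin x ->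
  ((hnorm x ^+ 2)%:E <= \esum_(j in [set: J]) (nsq (hdot x (b j)))%:E)%E.
Proof.
move=> hx; apply/lee_addgt0Pr => e e0.
have [s [c [us sc]]] := basis_uniq hx (ltac:(by rewrite sqrtr_gt0) : 0 < Num.sqrt e).
have : hnorm x ^+ 2 <= \sum_(j <- s) nsq (hdot x (b j)) + e.
  have : hnorm (x - \sum_(j <- s) c j *: b j) ^+ 2 <= e.
    rewrite -(sqr_sqrtr (ltW e0)) ler_pXn2r ?nnegrE ?sqrtr_ge0 ?hnorm_ge0 //.
    exact: ltW.
  rewrite (sqr_hnorm_sub_comb preH bb.1) //.
  have : 0 <= \sum_(j <- s) nsq (c j - hdot x (b j)).
    by apply: sumr_ge0 => j _; exact: nsq_ge0.
  lra.
rewrite -lee_fin EFinD => /le_trans; apply; rewrite leeD2r //.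
apply: esum_ge; exists [set` s]; first by split => //; exact: finite_seq.
by rewrite -fsbig_seq // sumEFin.
Qed.

End OrthonormalBasis.

(** * Lower bounds for a trace from an orthonormal family *)

Section TraceBound.
Context {R : realType} {H : hilbert R} (preH : prehilbert H).
Context (T : H -> H) (boT : bounded_operator T).

Lemma bounded_operator_const : exists2 C : R, 0 <= C &
  forall x, hin x -> hnorm (T x) <= C * hnorm x.
Proof.
have [_ _ [C hC]] := boT; exists `|C| => // x hx.
by apply: le_trans (hC x hx) _; rewrite ler_wpM2r ?hnorm_ge0 ?ler_norm.
Qed.

(** Linearity of [T] is known only up to [heq], so the equalities are chained by transitivity; the
    empty combination is settled by the norm bound. *)
Lemma bounded_operator_comb (J : choiceType) (b : J -> H) (s : seq J) (c : J -> R[i]) :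
  (forall j, hin (b j)) ->
  heq (T (\sum_(j <- s) c j *: b j)) (\sum_(j <- s) c j *: T (b j)).
Proof.
have [hT linT [C hC]] := boT; move=> hb.
have hcb j : hin (c j *: b j) by exact: hinZ.
have hcT j : hin (c j *: T (b j)) by apply: hinZ => //; exact: hT.
elim: s => [|j s IH].
  rewrite !big_nil /heq subr0; apply/eqP; rewrite eq_le hnorm_ge0 andbT.
  by rewrite (le_trans (hC _ (hin0 preH))) // (hnorm0 preH) mulr0.
rewrite !big_cons; have hs := hin_sum preH s hcb; have hTs := hin_sum preH s hcT.
apply: (heq_trans preH) (linT _ _ _ (hb j) hs) _.
- by apply: hT; apply: hinD.
- by apply: hinD => //; exact: hT.
- exact: hinD.
- by apply: (heq_lin preH) => //; try exact: hT; exact: heq_refl.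
Qed.

Context (J : choiceType) (b : J -> H) (bb : orthonormal_basis b) (g : J -> R).
Hypothesis g0 : forall j, 0 <= g j.
Hypothesis Tb : forall j, heq (T (b j)) ((g j)%:C *: b j).
Context (K : choiceType) (e : K -> H) (oe : orthonormal e) (h : K -> R).
Hypothesis h0 : forall k, 0 <= h k.
(** The only link between the two families: [e k] is orthogonal to every [b j] on which [T] acts by
    a scalar other than [h k]. In the application this is the orthogonality of eigenvectors with
    different eigenvalues. *)
Hypothesis gh : forall j k, hdot (b j) (e k) != 0 -> g j = h k.

Let hb j : hin (b j). Proof. exact: bb.1.1. Qed.
Let he k : hin (e k). Proof. exact: oe.1. Qed.

(* Both sides are quadratic in x; with x' the image of x under the square root of T,
   this is Bessel's inequality for x' and the family e. *)
Lemma trace_bessel_comb (F : seq K) (s : seq J) (c : J -> R[i]) :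
  uniq F -> uniq s ->
  \sum_(k <- F) h k * nsq (hdot (\sum_(j <- s) c j *: b j) (e k))
  <= Re (hdot (T (\sum_(j <- s) c j *: b j)) (\sum_(j <- s) c j *: b j)).
Proof.
have [hT _ _] := boT; move=> uF us; set x := \sum_(j <- s) c j *: b j.
have hx : hin x by apply: (hin_comb preH bb.1).
have hgb j : hin ((g j)%:C *: b j) by exact: hinZ.
pose gc j := (g j)%:C * c j.
have Tx : heq (T x) (\sum_(j <- s) gc j *: b j).
  apply: (heq_trans preH) (bounded_operator_comb s c hb) _.
  - exact: hT.
  - by apply: hin_sum => // j; apply: hinZ => //; exact: hT.
  - exact: (hin_comb preH bb.1).
  - elim: s {us x hx} => [|j s IH]; first by rewrite !big_nil; exact: heq_refl.
    rewrite !big_cons /gc [_ * c j]mulrC -scalerA; apply: (heq_lin preH) => //.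
    + exact: hT.
    + by apply: hin_sum => // i; apply: hinZ => //; exact: hT.
    + exact: (hin_comb preH bb.1).
rewrite (heq_hdotl preH (hT _ hx) _ hx Tx); last exact: (hin_comb preH bb.1).
rewrite (comb_hdot_comb preH bb.1) // Re_sum.
pose d j := (Num.sqrt (g j))%:C * c j.
set x' := \sum_(j <- s) d j *: b j.
have -> : \sum_(j <- s) Re (gc j * conjc (c j)) = hnorm x' ^+ 2.
  rewrite (sqr_hnorm_comb preH bb.1) //; apply: eq_bigr => j _.
  by rewrite /d nsqM nsqR sqr_sqrtr // /gc /nsq !ReImE /=; ring.
apply: le_trans (bessel preH oe (hin_comb preH bb.1 s d) uF).
apply: ler_sum => k _.
rewrite !(comb_hdot preH bb.1) // -(sqr_sqrtr (h0 k)) -nsqR -nsqM mulr_sumr.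
rewrite (eq_bigr (fun j => d j * hdot (b j) (e k))) // => j _.
(* Only those j with [g j] equal to [h k] contribute to the coefficient of x along [e k], so the
   square root of [h k] can be moved inside the sum as that of [g j]. *)
have [->|/gh ghjk] := eqVneq (hdot (b j) (e k)) 0; first by rewrite !mulr0.
by rewrite /d -ghjk; ring.
Qed.

(** Both sides are continuous in x, and the inequality is known on the dense set of finite
    combinations of the eigenbasis. *)
Lemma trace_bessel (F : seq K) x : uniq F -> hin x ->
  \sum_(k <- F) h k * nsq (hdot x (e k)) <= Re (hdot (T x) x).
Proof.
move=> uF hx; have [hT linT _] := boT; have [C C0 hC] := bounded_operator_const.
pose G := \sum_(k <- F) h k.
have G0 : 0 <= G by apply: sumr_ge0.
have N0 := hnorm_ge0 x.
pose M := (2 * hnorm x + 1) * (G + C).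
have M0 : 0 <= M by rewrite mulr_ge0 ?addr_ge0 ?mulr_ge0.
apply/ler_addgt0Pr => eps eps0.
(* Replacing x by y changes the left side by at most G d (2‖x‖ + 1), the [e k] being unit vectors,
   and the right side by at most C d (2‖x‖ + 1); together this is d M. The cap at 1 gives ‖y‖ <= ‖x‖
   + 1. *)
pose d := Num.min 1 (eps / (M + 1)).
have d0 : 0 < d by rewrite lt_min ltr01 divr_gt0 // ltr_wpDl.
have d1 : d <= 1 by rewrite ge_min lexx.
have dM : d * M <= eps.
  apply: (@le_trans _ _ (eps / (M + 1) * M)).
    by rewrite ler_wpM2r // ge_min lexx orbT.
  by rewrite mulrAC ler_pdivrMr ?ltr_wpDl // ler_wpM2l ?lerDl // ltW.
have [s [c [us sc]]] := basis_uniq bb hx d0.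
set y := \sum_(j <- s) c j *: b j in sc.
have hy : hin y := hin_comb preH bb.1 s c.
have hxy : hin (x - y) := hinB preH hx hy.
have yineq : \sum_(k <- F) h k * nsq (hdot y (e k)) <= Re (hdot (T y) y).
  exact: trace_bessel_comb.
have nxy : hnorm y <= hnorm x + d.
  have -> : y = x - (x - y) by rewrite opprB addrC subrK.
  by apply: le_trans (hnormB preH hx hxy) _; rewrite lerD2l ltW.
have ny0 := hnorm_ge0 y; have nd0 := hnorm_ge0 (x - y).
have L : \sum_(k <- F) h k * nsq (hdot x (e k))
    <= \sum_(k <- F) h k * nsq (hdot y (e k)) + G * (d * (2 * hnorm x + 1)).
  rewrite mulr_suml -big_split /=; apply: ler_sum => k _; rewrite -mulrDr ler_wpM2l //.
  have ek : hnorm (e k) = 1.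
    have := sqr_hnorm preH (he k); rewrite oe.2 eqxx /= => /eqP.
    by rewrite sqrp_eq1 ?hnorm_ge0 // => /eqP.
  have n1 z : hin z -> nsq (hdot z (e k)) <= hnorm z ^+ 2.
    by move=> hz; have := cauchy_schwarz preH hz (he k); rewrite ek expr1n mulr1.
  apply: nsq_le_add; [exact: ltW | lra | |].
  - rewrite -(hdotBl preH) //; apply: le_trans (n1 _ hxy) _.
    by rewrite ler_pXn2r ?nnegrE // ltW.
  - rewrite -(hdotDl preH) //; apply: le_trans (n1 _ (hinD preH hx hy)) _.
    rewrite ler_pXn2r ?nnegrE ?hnorm_ge0 //; last by lra.
    by apply: le_trans (hnormD preH hx hy) _; lra.
have U : Re (hdot (T y) y) <= Re (hdot (T x) x) + C * (d * (2 * hnorm x + 1)).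
  have hyx := hinB preH hy hx.
  have hTx := hT _ hx; have hTy := hT _ hy.
  have nyx : hnorm (y - x) <= d by rewrite (hnorm_subC preH) // ltW.
  have E : Re (hdot (T y) y) - Re (hdot (T x) x)
      = Re (hdot (T y) (y - x)) + Re (hdot (T (y - x)) x).
    have hxy1 : heq (T (- 1 *: x + y)) (- 1 *: T x + T y) by exact: linT.
    rewrite !scaleN1r ![- _ + _]addrC in hxy1.
    have -> : hdot (T (y - x)) x = hdot (T y - T x) x.
      apply: (heq_hdotl preH) => //; first exact: hT.
      by apply: hinD => //; exact: hinN.
    rewrite (hdotBr preH) // (hdotDl preH) ?(hdotNl preH) //; last exact: hinN.
    by rewrite !ReImE; ring.
  have e1 := le_trans (ler_norm _) (abs_Re_hdot_le preH hTy hyx).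
  have e2 := le_trans (ler_norm _) (abs_Re_hdot_le preH (hT _ hyx) hx).
  have e3 : hnorm (T y) * hnorm (y - x) <= C * (hnorm x + 1) * d.
    apply: ler_pM => //; rewrite ?hnorm_ge0 //.
    by apply: le_trans (hC _ hy) _; apply: ler_wpM2l => //; lra.
  have e4 : hnorm (T (y - x)) * hnorm x <= C * d * hnorm x.
    by rewrite ler_wpM2r // (le_trans (hC _ hyx)) // ler_wpM2l.
  lra.
have : C * (d * (2 * hnorm x + 1)) + G * (d * (2 * hnorm x + 1)) <= eps.
  by apply: le_trans dM; rewrite le_eqVlt; apply/orP; left; apply/eqP; rewrite /M; ring.
lra.
Qed.

(** The basis [a] may be any basis, unrelated to the eigenbasis. Each diagonal entry at [a i]
    dominates the sum over k of [h k] times the squared coefficient of [a i] along [e k]; after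
    exchanging the sums, Parseval's inequality for the unit vector [e k] in the basis [a] leaves at
    least [h k]. *)
Lemma trace_le (I : choiceType) (a : I -> H) (F : seq K) : uniq F ->
  orthonormal_basis a ->
  ((\sum_(k <- F) h k)%:E <= \esum_(i in [set: I]) (Re (hdot (T (a i)) (a i)))%:E)%E.
Proof.
move=> uF ba.
apply: (@le_trans _ _ (\esum_(i in [set: I]) \sum_(k <- F) (h k * nsq (hdot (a i) (e k)))%:E)%E).
  rewrite esum_sum; last by move=> i k _ _; rewrite lee_fin mulr_ge0 ?nsq_ge0.
  rewrite -sumEFin; apply: lee_sum => k _.
  have ek : hnorm (e k) ^+ 2 = 1.
    by rewrite (sqr_hnorm preH (he k)) oe.2 eqxx.
  have p1 := parseval_le preH ba (he k); rewrite ek in p1.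
  rewrite esumZl // => [|i]; last exact: nsq_ge0.
  apply: lee_pemulr; first by rewrite lee_fin.
  apply: le_trans p1 _; apply: le_esum => i _.
  by rewrite (hdotC preH (ba.1.1 i) (he k)) nsqJ.
apply: le_esum => i _; rewrite sumEFin lee_fin.
by apply: trace_bessel => //; exact: ba.1.1.
Qed.

End TraceBound.

(** * Sums over arbitrary index types *)

Section RealSums.
Context {R : realType} {I : choiceType}.
Implicit Types (u v : I -> R) (z w : I -> R[i]).

Definition nsum u : \bar R := (\esum_(i in [set: I]) (u i)%:E)%E.

Definition abs_summable u : Prop := (nsum (fun i => `|u i|%R) < +oo)%E.

Lemma nsum_ge0 u : (forall i, 0 <= u i) -> (0 <= nsum u)%E.
Proof. by move=> u0; apply: esum_ge0 => i _; rewrite lee_fin. Qed.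

Lemma le_nsum u v : (forall i, u i <= v i) -> (nsum u <= nsum v)%E.
Proof. by move=> uv; apply: le_esum => i _; rewrite lee_fin. Qed.

Lemma eq_nsum u v : (forall i, u i = v i) -> nsum u = nsum v.
Proof. by move=> uv; apply: eq_esum => i _; rewrite uv. Qed.

Lemma nsumD u v : (forall i, 0 <= u i) -> (forall i, 0 <= v i) ->
  nsum (fun i => u i + v i) = (nsum u + nsum v)%E.
Proof. by move=> u0 v0; rewrite -esumD // => i _; rewrite lee_fin. Qed.

Lemma nsumZ c u : 0 <= c -> (forall i, 0 <= u i) ->
  nsum (fun i => c * u i) = (c%:E * nsum u)%E.
Proof. exact: esumZl. Qed.

Lemma nsum_fin u : (forall i, 0 <= u i) -> (nsum u < +oo)%E -> nsum u \is a fin_num.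
Proof. by move=> u0 su; rewrite ge0_fin_numE // nsum_ge0. Qed.

Lemma nsum_supp1 k u : 0 <= u k -> (forall i, i != k -> u i = 0) ->
  nsum u = (u k)%:E.
Proof.
move=> uk u0; transitivity (\esum_(i in [set k]) (u i)%:E)%E.
  rewrite esum_mkcond; apply: eq_esum => i _; case: ifPn => //.
  by rewrite notin_setE => /eqP /u0 ->.
by rewrite esum_set1 ?lee_fin.
Qed.

Lemma abs_summable_le u v : (forall i, `|u i| <= v i) -> (nsum v < +oo)%E ->
  abs_summable u.
Proof. by move=> uv; apply: le_lt_trans; exact: le_nsum. Qed.

Lemma abs_summableD u v : abs_summable u -> abs_summable v ->
  abs_summable (fun i => u i + v i).
Proof.
move=> su sv; apply: (@abs_summable_le _ (fun i => `|u i| + `|v i|)) => [i|].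
  exact: ler_normD.
by rewrite nsumD // lte_add_pinfty.
Qed.

Lemma abs_summableZ c u : abs_summable u -> abs_summable (fun i => c * u i).
Proof.
move=> su; apply: (@abs_summable_le _ (fun i => `|c| * `|u i|)) => [i|].
  by rewrite normrM.
rewrite nsumZ // -(fineK (nsum_fin _ su)) //= -EFinM ltry //.
Qed.

Lemma rsum_nneg u : (forall i, 0 <= u i) -> rsum u = fine (nsum u).
Proof.
move=> u0; rewrite /rsum /= [X in _ - fine X]esum1 ?subr0 => [|i _].
  congr fine; apply: eq_esum => i _; rewrite funeposE /=.
  by apply/max_idPl; rewrite lee_fin.
by rewrite funenegE; apply/max_idPr; rewrite lee_fin oppr_le0.
Qed.

(** The value of [rsum] does not depend on how a family is written as a difference of nonnegative
    summable ones. The rules for sums, opposites and scalar multiples thereby reduce to those for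
    nonnegative sums. *)
Lemma rsum_sub a b : (forall i, 0 <= a i) -> (forall i, 0 <= b i) ->
  (nsum a < +oo)%E -> (nsum b < +oo)%E ->
  rsum (fun i => a i - b i) = fine (nsum a) - fine (nsum b).
Proof.
move=> a0 b0 sa sb.
have S (u : I -> R) : (forall i, 0 <= u i) -> (nsum u < +oo)%E ->
    summable [set: I] (EFin \o u).
  move=> u0; apply: le_lt_trans; apply: le_esum => i _ /=.
  by rewrite ger0_norm.
have := esumB (S a a0 sa) (S b b0 sb) (fun i _ => a0 i) (fun i _ => b0 i).
move=> /(congr1 fine) E.
transitivity (fine (nsum a - nsum b)%E); last by rewrite fineB // nsum_fin.
etransitivity; last exact: E.
have F (w : I -> \bar R) : (forall i, 0 <= w i)%E ->
    (forall i, w i <= (`|a i| + `|b i|)%:E)%E ->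
    (\esum_(i in [set: I]) w i)%E \is a fin_num.
  move=> w0 wab; rewrite ge0_fin_numE; last by apply: esum_ge0.
  apply: (@le_lt_trans _ _ (nsum (fun i => `|a i| + `|b i|))).
    by apply: le_esum => i _.
  rewrite nsumD // lte_add_pinfty //.
    by rewrite (eq_nsum (v := a)) // => i; rewrite ger0_norm.
  by rewrite (eq_nsum (v := b)) // => i; rewrite ger0_norm.
rewrite fineB //; apply: F => i; rewrite ?funeposE ?funenegE.
- by rewrite le_max lexx orbT.
- rewrite ge_max !lee_fin addr_ge0 // andbT.
  exact: le_trans (ler_norm _) (ler_normB _ _).
- by rewrite le_max lexx orbT.
- rewrite ge_max !lee_fin addr_ge0 // andbT.
  by apply: le_trans (ler_norm _) _; rewrite normrN; exact: ler_normB.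
Qed.

Lemma shift_ge0 u i : 0 <= `|u i| + u i.
Proof. by rewrite -[u i]opprK subr_ge0 opprK -normrN ler_norm. Qed.

Lemma abs_summable_shift u : abs_summable u ->
  (nsum (fun i => (`|u i| + u i)%R) < +oo)%E.
Proof.
move=> su; apply: (@le_lt_trans _ _ (nsum (fun i => `|u i| + `|u i|))).
  by apply: le_nsum => i; rewrite lerD2l ler_norm.
by rewrite nsumD // lte_add_pinfty.
Qed.

(** The decomposition u = (|u| + u) - |u| has two nonnegative terms and requires no case distinction
    on signs, unlike positive and negative parts. *)
Lemma rsum_shift u : abs_summable u ->
  rsum u = fine (nsum (fun i => `|u i| + u i)) - fine (nsum (fun i => `|u i|)).
Proof.
move=> su; rewrite -rsum_sub //; first by congr rsum; apply/funext => i; ring.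
- exact: shift_ge0.
- exact: abs_summable_shift.
Qed.

Lemma rsumD u v : abs_summable u -> abs_summable v ->
  rsum (fun i => u i + v i) = rsum u + rsum v.
Proof.
move=> su sv; have su' := abs_summable_shift su; have sv' := abs_summable_shift sv.
rewrite (rsum_shift su) (rsum_shift sv) addrACA -opprD -!fineD ?nsum_fin //;
  try by move=> i; exact: shift_ge0.
rewrite -!nsumD //; try by move=> i; exact: shift_ge0.
rewrite -rsum_sub.
- by congr rsum; apply/funext => i; ring.
- by move=> i; rewrite addr_ge0 // shift_ge0.
- by move=> i; rewrite addr_ge0.
- by rewrite nsumD ?lte_add_pinfty // => i; exact: shift_ge0.
- by rewrite nsumD ?lte_add_pinfty.
Qed.

Lemma rsumN u : abs_summable u -> rsum (fun i => - u i) = - rsum u.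
Proof.
move=> su; rewrite (rsum_shift su) opprB -rsum_sub //.
- by congr rsum; apply/funext => i; ring.
- by move=> i; exact: shift_ge0.
- exact: abs_summable_shift.
Qed.

Lemma rsumZ c u : abs_summable u -> rsum (fun i => c * u i) = c * rsum u.
Proof.
move=> su; have su' := abs_summable_shift su.
have Z k : 0 <= k -> rsum (fun i => k * u i) = k * rsum u.
  move=> k0; have u0 := fun i => shift_ge0 u i.
  have f1 := nsum_fin u0 su'.
  have f2 : nsum (fun i => `|u i|) \is a fin_num by exact: nsum_fin.
  have fZ (x : \bar R) : x \is a fin_num -> k * fine x = fine (k%:E * x)%E.
    by move=> fx; rewrite fineM.
  rewrite (rsum_shift su) mulrBr !fZ // -!nsumZ // -rsum_sub.
  - by congr rsum; apply/funext => i; ring.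
  - by move=> i; rewrite mulr_ge0.
  - by move=> i; rewrite mulr_ge0.
  - by rewrite nsumZ // -(fineK f1) -EFinM ltry.
  - by rewrite nsumZ // -(fineK f2) -EFinM ltry.
have [c0|c0] := leP 0 c; first exact: Z.
rewrite -[c]opprK mulNr -Z ?oppr_ge0 1?ltW // -rsumN; last exact: abs_summableZ.
by congr rsum; apply/funext => i; rewrite !mulNr.
Qed.

Lemma rsum_supp1 k u : (forall i, i != k -> u i = 0) -> rsum u = u k.
Proof.
move=> u0; rewrite rsum_shift; last first.
  rewrite /abs_summable (@nsum_supp1 k) ?ltry // => i ik.
  by rewrite u0 // normr0.
rewrite (@nsum_supp1 k (fun i => `|u i|)) //; last by move=> i /u0 ->; rewrite normr0.
rewrite (@nsum_supp1 k (fun i => `|u i| + u i)) /=; first by rewrite addrAC subrr add0r.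
  exact: shift_ge0.
by move=> i /u0 ->; rewrite normr0 addr0.
Qed.

Definition csummable z : Prop :=
  abs_summable (fun i => Re (z i)) /\ abs_summable (fun i => Im (z i)).

Lemma csumD z w : csummable z -> csummable w ->
  csum (fun i => z i + w i) = csum z + csum w.
Proof.
move=> [zr zi] [wr wi]; apply: complex_eqP => /=; rewrite -rsumD //;
by congr rsum; apply/funext => i; rewrite !ReImE.
Qed.

Lemma Re_mulE (c : R[i]) z :
  (fun i => Re (c * z i)) = (fun i => Re c * Re (z i) + (- Im c) * Im (z i)).
Proof. by apply/funext => i; rewrite Re_mul mulNr. Qed.

Lemma Im_mulE (c : R[i]) z :
  (fun i => Im (c * z i)) = (fun i => Re c * Im (z i) + Im c * Re (z i)).
Proof. by apply/funext => i; rewrite Im_mul. Qed.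

Lemma csummableZ (c : R[i]) z : csummable z -> csummable (fun i => c * z i).
Proof.
by move=> [zr zi]; split; rewrite ?Re_mulE ?Im_mulE;
  apply: abs_summableD; exact: abs_summableZ.
Qed.

Lemma csumZ (c : R[i]) z : csummable z -> csum (fun i => c * z i) = c * csum z.
Proof.
move=> [zr zi]; apply: complex_eqP; rewrite ?Re_mul ?Im_mul /= ?Re_mulE ?Im_mulE.
  by rewrite rsumD ?rsumZ ?mulNr //; exact: abs_summableZ.
by rewrite rsumD ?rsumZ //; exact: abs_summableZ.
Qed.

Lemma csum_conj z : csummable z -> csum (fun i => conjc (z i)) = conjc (csum z).
Proof.
move=> [zr zi]; apply: complex_eqP; rewrite ?Re_conjc ?Im_conjc /=.
  by congr rsum; apply/funext => i; rewrite Re_conjc.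
by rewrite -rsumN //; congr rsum; apply/funext => i; rewrite Im_conjc.
Qed.

Lemma csum_supp1 k z : (forall i, i != k -> z i = 0) -> csum z = z k.
Proof.
by move=> z0; apply: complex_eqP => /=; rewrite (@rsum_supp1 k) // => i /z0 ->.
Qed.

End RealSums.

(** The fibres of [tag] partition the index type, and the fibre over i is a copy of [J i]. *)
Lemma nsum_sigT (R : realType) (I : choiceType) (J : I -> choiceType)
    (a : {i : I & J i} -> R) : (forall p, 0 <= a p) ->
  nsum a = (\esum_(i in [set: I]) nsum (fun j : J i => a (Tagged J j)))%E.
Proof.
move=> a0.
transitivity (\esum_(i in [set: I]) \esum_(p in [set p | tag p = i]) (a p)%:E)%E.
  rewrite esum_esum => [|i p _ _]; last by rewrite lee_fin.
  apply: (@reindex_esum _ _ _ _ _ snd); split => //=.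
  - move=> [i p] [i' p']; rewrite !inE /= => -[_ <-] [_ <-] /= <- //.
  - by move=> p _; exists (tag p, p).
apply: eq_esum => i _; apply: (@reindex_esum _ _ _ setT _ (fun j : J i => Tagged J j)); split => //=.
- by move=> j j' _ _; exact: eq_from_Tagged.
- by move=> [i' j] /= ii'; move: j; rewrite ii' => j; exists j.
Qed.

(** * Hilbert sums *)

Lemma sqrrD_le (R : realFieldType) (a b : R) : (a + b) ^+ 2 <= 2 * a ^+ 2 + 2 * b ^+ 2.
Proof.
rewrite -subr_ge0; have -> : 2 * a ^+ 2 + 2 * b ^+ 2 - (a + b) ^+ 2 = (a - b) ^+ 2 by ring.
exact: sqr_ge0.
Qed.

Lemma mulr_le_sqrD (R : realFieldType) (a b : R) : a * b <= a ^+ 2 + b ^+ 2.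
Proof.
have := sqr_ge0 (a - b); have := sqr_ge0 a; have := sqr_ge0 b.
have -> : (a - b) ^+ 2 = a ^+ 2 + b ^+ 2 - 2 * (a * b) by ring.
lra.
Qed.

Section HilbertSum.
Context {R : realType} {I : choiceType} {H : I -> hilbert R}.
Hypothesis preH : forall i, prehilbert (H i).
Notation HS := (hsum H).
Implicit Types (x y z : HS).

(** [csum] is a total function, so its algebraic laws become available only after absolute
    convergence: every term is bounded by the sum of the two squared norms. *)
Lemma hsum_csummable x y : hin x -> hin y -> csummable (fun i => hdot (x i) (y i)).
Proof.
move=> [hx sx] [hy sy].
have le i : hnorm (x i) * hnorm (y i) <= hnorm (x i) ^+ 2 + hnorm (y i) ^+ 2.
  exact: mulr_le_sqrD.
have S : (nsum (fun i => (hnorm (x i) ^+ 2 + hnorm (y i) ^+ 2)%R) < +oo)%E.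
  by rewrite nsumD ?lte_add_pinfty // => i; exact: sqr_ge0.
split; apply: abs_summable_le S => i; apply: le_trans (le i).
  by apply: abs_Re_hdot_le.
by apply: abs_Im_hdot_le.
Qed.

Lemma prehilbert_hsum : prehilbert HS.
Proof.
split.
- split=> [i|]; first exact: (hin0 (preH i)).
  rewrite [X in (X < _)%E]esum1 ?ltry // => i _.
  by rewrite (hnorm0 (preH i)) expr0n.
- move=> a x y [hx sx] [hy sy]; split=> [i|]; first exact: (hin_lin (preH i)).
  apply: (@le_lt_trans _ _
    (nsum (fun i => 2 * nsq a * hnorm (x i) ^+ 2 + 2 * hnorm (y i) ^+ 2))).
    apply: le_nsum => i.
    have hax := hinZ (preH i) a (hx i).
    have : hnorm (a *: x i + y i) ^+ 2 <= (hnorm (a *: x i) + hnorm (y i)) ^+ 2.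
      by rewrite ler_pXn2r ?nnegrE ?addr_ge0 ?hnorm_ge0 // (hnormD (preH i)).
    move=> /le_trans; apply.
    rewrite -mulrA -[nsq a](sqr_sqrtr (nsq_ge0 a)) -exprMn -(hnormZ (preH i)) //.
    exact: sqrrD_le.
  have P i : 0 <= 2 * nsq a by rewrite mulr_ge0 ?nsq_ge0.
  rewrite nsumD //; last 2 first.
  + by move=> i; rewrite mulr_ge0 ?sqr_ge0 ?mulr_ge0 ?nsq_ge0.
  + by move=> i; rewrite mulr_ge0 ?sqr_ge0.
  rewrite !nsumZ //; try by move=> i; exact: sqr_ge0.
  + have fx := nsum_fin (fun i => sqr_ge0 (hnorm (x i))) sx.
    have fy := nsum_fin (fun i => sqr_ge0 (hnorm (y i))) sy.
    by rewrite -(fineK fx) -(fineK fy) -!EFinM -EFinD ltry.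
  + by rewrite mulr_ge0 ?nsq_ge0.
- move=> a x y z hx hy hz; have [hx1 _] := hx; have [hy1 _] := hy; have [hz1 _] := hz.
  rewrite /= -csumZ; last exact: hsum_csummable.
  rewrite -csumD; [|by apply: csummableZ; exact: hsum_csummable|exact: hsum_csummable].
  by congr csum; apply/funext => i; rewrite -(hdot_lin (preH i)).
- move=> x y hx hy; rewrite -[hdot x y]/(csum (fun i => hdot (x i) (y i))).
  rewrite -csum_conj; last exact: hsum_csummable.
  rewrite -[LHS]/(csum (fun i => hdot (y i) (x i))).
  by congr csum; apply/funext => i; rewrite -(hdotC (preH i)) //; [exact: hx.1|exact: hy.1].
- move=> x hx; rewrite /= rsum_nneg; last by move=> i; apply: (hdot_ge0 (preH i)); exact: hx.1.
  by rewrite fine_ge0 // nsum_ge0 // => i; apply: (hdot_ge0 (preH i)); exact: hx.1.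
Qed.

Lemma hsum_hnorm x : hin x ->
  (hnorm x ^+ 2)%:E = nsum (fun i => hnorm (x i) ^+ 2).
Proof.
move=> hx; have [hx1 hx2] := hx; have P i : 0 <= hnorm (x i) ^+ 2 by exact: sqr_ge0.
rewrite (sqr_hnorm prehilbert_hsum hx) /= rsum_nneg => [|i]; last exact: (hdot_ge0 (preH i)).
rewrite -(fineK (nsum_fin P hx2)); congr (fine _)%:E; apply: eq_nsum => i.
by rewrite (sqr_hnorm (preH i)).
Qed.

Lemma hsum_heq x y : hin x -> hin y -> (forall i, heq (x i) (y i)) -> heq x y.
Proof.
move=> hx hy xy; have := hsum_hnorm (hinB prehilbert_hsum hx hy).
rewrite /nsum esum1 => [[/eqP]|i _]; first by rewrite sqrf_eq0 => /eqP.
by rewrite [hnorm _](xy i) expr0n.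
Qed.

Definition emb i (v : H i) : HS := eqtype.dfwith (fun k => 0 : H k) v.

Lemma emb_in i (v : H i) : (emb v) i = v.
Proof. exact: eqtype.dfwith_in. Qed.

Lemma emb_out i k (v : H i) : k != i -> (emb v) k = 0.
Proof. by rewrite eq_sym; exact: eqtype.dfwith_out. Qed.

Lemma emb_lin i a (v w : H i) : emb (a *: v + w) = a *: emb v + emb w.
Proof.
apply: functional_extensionality_dep => k; rewrite /= [RHS]/(_ *: _ + _).
have [<-|ki] := eqVneq i k.
  by rewrite emb_in -[RHS]/(a *: (emb v) i + (emb w) i) !emb_in.
rewrite emb_out 1?eq_sym // -[RHS]/(a *: (emb v) k + (emb w) k).
by rewrite !emb_out 1?eq_sym // scaler0 addr0.
Qed.

Lemma emb0 i : emb (0 : H i) = 0.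
Proof.
apply: functional_extensionality_dep => k.
by have [<-|ki] := eqVneq i k; [rewrite emb_in|rewrite emb_out 1?eq_sym].
Qed.

Lemma embZ i a (v : H i) : emb (a *: v) = a *: emb v.
Proof. by rewrite -[a *: v]addr0 emb_lin emb0 addr0. Qed.

Lemma embD i (v w : H i) : emb (v + w) = emb v + emb w.
Proof. by rewrite -[v]scale1r emb_lin !scale1r. Qed.

Lemma embB i (v w : H i) : emb (v - w) = emb v - emb w.
Proof. by rewrite embD -scaleN1r embZ scaleN1r. Qed.

Lemma emb_sum i J (s : seq J) (F : J -> H i) :
  emb (\sum_(j <- s) F j) = \sum_(j <- s) emb (F j).
Proof. by apply: (big_morph (@emb i)); [exact: embD | exact: emb0]. Qed.

Lemma hin_emb i (v : H i) : hin v -> hin (emb v).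
Proof.
move=> hv; split=> [k|].
  have [<-|ki] := eqVneq i k; first by rewrite emb_in.
  by rewrite emb_out 1?eq_sym //; exact: (hin0 (preH k)).
change (nsum (fun k => (hnorm ((emb v) k) ^+ 2)%R) < +oo)%E.
rewrite (@nsum_supp1 _ _ i) ?ltry // ?sqr_ge0 // => k ki.
by rewrite emb_out // (hnorm0 (preH k)) expr0n.
Qed.

Lemma hdot_emb x i (v : H i) : hin x -> hin v -> hdot x (emb v) = hdot (x i) v.
Proof.
move=> [hx _] hv; rewrite /= (@csum_supp1 _ _ i) ?emb_in // => k ki.
rewrite emb_out // (hdotC (preH k) (hin0 (preH k)) (hx k)).
by rewrite (hdot0l (preH k)) // conjc0.
Qed.

Lemma hnorm_emb i (v : H i) : hin v -> hnorm (emb v) = hnorm v.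
Proof. by move=> hv; rewrite /hnorm hdot_emb ?emb_in //; exact: hin_emb. Qed.

(** A finite partial sum of the squared norms comes within e² of the total. The truncation y of x to
    these indices and the rest x - y have disjoint supports, hence their squared norms add up to
    that of x. *)
Lemma hsum_tail x e : hin x -> 0 < e ->
  exists s : seq I, hnorm (x - \sum_(i <- s) emb (x i)) < e.
Proof.
move=> hx e0; have [hx1 hx2] := hx.
have P i : 0 <= hnorm (x i) ^+ 2 by exact: sqr_ge0.
have [_ [X [finX _] <-]] := ub_ereal_sup_adherent
  (exprn_gt0 2 e0) (nsum_fin P hx2 : esum _ _ \is a fin_num).
rewrite fsbig_finite //=; set s := (finmap.enum_fset _) => sX; exists s.
have {}sX : (nsum (fun i => (hnorm (x i) ^+ 2)%R) - (e ^+ 2)%:E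
    < \sum_(i <- s) (hnorm (x i) ^+ 2)%:E)%E by exact: sX.
have us : uniq s by exact: finmap.fset_uniq.
set y := \sum_(i <- s) emb (x i).
have hy : hin y by apply: (hin_sum prehilbert_hsum) => i; apply: hin_emb.
have yE k : y k = if k \in s then x k else 0.
  have -> : y k = \sum_(i <- s) (emb (x i)) k.
    by rewrite /y; elim/big_ind2: _ => // a b c d <- <-.
  case: ifPn => ks.
    rewrite (bigD1_seq k) //= emb_in big1 ?addr0 // => i ik.
    by rewrite emb_out 1?eq_sym.
  rewrite big1_seq // => i /andP[_ si]; rewrite emb_out //.
  by apply: contraNneq ks => ->.
have hxy := hinB prehilbert_hsum hx hy.
have S : nsum (fun i => hnorm (x i) ^+ 2)
    = (nsum (fun i => (hnorm ((x - y) i) ^+ 2)%R) +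
       nsum (fun i => (hnorm (y i) ^+ 2)%R))%E.
  rewrite -nsumD; try by move=> i; exact: sqr_ge0.
  apply: eq_nsum => i; rewrite -[(x - y) i]/(x i - y i) yE.
  by case: ifP => _; rewrite ?subrr ?subr0 (hnorm0 (preH i)) expr0n ?add0r ?addr0.
have Sy : nsum (fun i => hnorm (y i) ^+ 2) = (\sum_(i <- s) (hnorm (x i) ^+ 2)%:E)%E.
  rewrite fsbig_seq //.
  rewrite -esum_fset; [|exact: finite_seq|by move=> i _; rewrite lee_fin].
  rewrite [RHS]esum_mkcond; apply: eq_esum => i _; rewrite yE.
  have -> : (i \in [set` s]) = (i \in s) by apply/idP/idP; rewrite inE.
  by case: ifP => // _; rewrite (hnorm0 (preH i)) expr0n.
have : (nsum (fun i => (hnorm ((x - y) i) ^+ 2)%R) < (e ^+ 2)%:E)%E.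
  move: sX; rewrite S Sy -(hsum_hnorm hxy) sumEFin.
  by rewrite -!EFinD !lte_fin; lra.
rewrite -hsum_hnorm // lte_fin ltr_pXn2r ?nnegrE ?hnorm_ge0 //.
exact: ltW.
Qed.

Lemma hnorm_sum_le J (s : seq J) (F : J -> HS) : (forall j, hin (F j)) ->
  hnorm (\sum_(j <- s) F j) <= \sum_(j <- s) hnorm (F j).
Proof.
move=> hF; elim: s => [|j s IH]; first by rewrite !big_nil (hnorm0 prehilbert_hsum).
rewrite !big_cons; apply: le_trans (hnormD prehilbert_hsum _ _) _ => //.
  exact: (hin_sum prehilbert_hsum).
by rewrite lerD2l.
Qed.

Context {J : I -> choiceType} (b : forall i, J i -> H i).
Hypothesis bb : forall i, orthonormal_basis (@b i).

Definition hsum_basis (p : {i : I & J i}) : HS := emb (b (tagged p)).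

Lemma hsum_orthonormal : orthonormal hsum_basis.
Proof.
have hb i j : hin (@b i j) by exact: (bb i).1.1.
split=> [p|[i j] [i' j']]; first exact: hin_emb.
rewrite -[LHS]/(hdot (emb (@b i j)) (emb (@b i' j'))) hdot_emb //; last exact: hin_emb.
have [E|ii'] := eqVneq i' i.
  subst i'; rewrite emb_in (bb i).1.2.
  suff -> : (existT _ i j == existT _ i j' :> {i & J i}) = (j == j') by [].
  by rewrite -tag_eqE /tag_eq /= eqxx tagged_asE.
rewrite emb_out // (hdot0l (preH i')) //.
case: eqP => // [[E _]]; by rewrite E eqxx in ii'.
Qed.

(** Half of e pays for truncating x to finitely many components, the other half for approximating
    each of these in its own basis. *)
Lemma hsum_orthonormal_basis : orthonormal_basis hsum_basis.
Proof.
split; first exact: hsum_orthonormal.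
move=> x hx e e0; have [hx1 _] := hx.
have e20 : 0 < e / 2 by rewrite divr_gt0.
have [s sE] := hsum_tail hx e20.
(* The error is shared among the components of [s]; the successor keeps the denominator nonzero when
   [s] is empty. *)
pose d := e / 2 / (size s).+1%:R.
have d0 : 0 < d by rewrite divr_gt0.
pose tc i := cid ((bb i).2 (x i) (hx1 i) d d0); pose t i := projT1 (tc i).
pose c i := projT1 (cid (projT2 (tc i))).
have cE i : hnorm (x i - \sum_(j <- t i) c i j *: b j) < d.
  exact: (projT2 (cid (projT2 (tc i)))).
exists [seq Tagged J j | i <- s, j <- t i], (fun p => c (tag p) (tagged p)).
pose S i := \sum_(j <- t i) c i j *: b j.
have hS i : hin (S i) by apply: (hin_comb (preH i)); exact: (bb i).1.
have -> : \sum_(p <- [seq Tagged J j | i <- s, j <- t i])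
    c (tag p) (tagged p) *: hsum_basis p = \sum_(i <- s) emb (S i).
  rewrite big_allpairs_dep /=; apply: eq_bigr => i _; rewrite emb_sum.
  by apply: eq_bigr => j _; rewrite embZ.
set y := \sum_(i <- s) emb (x i) in sE; set z := \sum_(i <- s) emb (S i).
have hy : hin y by apply: (hin_sum prehilbert_hsum) => i; exact: hin_emb.
have hz : hin z by apply: (hin_sum prehilbert_hsum) => i; exact: hin_emb.
rewrite -[x - z](subrKA y).
apply: le_lt_trans (hnormD prehilbert_hsum _ _) _; try exact: (hinB prehilbert_hsum).
rewrite [ltRHS]splitr ltr_leD //.
have -> : y - z = \sum_(i <- s) emb (x i - S i).
  by rewrite /y /z -sumrB; apply: eq_bigr => i _; rewrite embB.
have hxS i : hin (x i - S i) by exact: (hinB (preH i)).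
apply: le_trans (hnorm_sum_le _ _) _ => [i|]; first exact: hin_emb.
apply: (@le_trans _ _ (\sum_(i <- s) d)).
  by apply: ler_sum => i _; rewrite hnorm_emb // ltW // cE.
rewrite big_const_seq iter_addr_0 count_predT -[_ *+ size s]mulr_natr /d mulrAC ler_pdivrMr //.
by rewrite ler_wpM2l ?ler_nat // ltW.
Qed.

End HilbertSum.

(** * Direct sums of modules with an explicit eigenbasis *)

Section Eigensystems.
Context {R : realType}.
Implicit Types (g : R -> R) (C t : R).

(** All that sufficiency needs of a module, in a form stable under direct sums. The bound [C] is
    common to all summands, since a direct sum of operators is bounded only if they are uniformly
    so; the trace bound [t] varies and is summed. [es_dirac0] is required because an eigenvector of
    one summand has component 0 in all the others, and the Dirac relation of the sum is checked
    componentwise. *)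
Record eigensystem (M : ufmodule R) g C t := Eigensystem {
  es_pre : prehilbert M ;
  es_index : choiceType ;
  es_vec : es_index -> M ;
  es_val : es_index -> R ;
  es_op : M -> M ;
  es_basis : orthonormal_basis es_vec ;
  es_dirac0 : dirac (0 : M) 0 ;
  es_dirac : forall j, dirac (es_vec j) ((es_val j)%:C *: es_vec j) ;
  es_hin : forall x, hin x -> hin (es_op x) ;
  es_lin : forall a x y, hin x -> hin y ->
    heq (es_op (a *: x + y)) (a *: es_op x + es_op y) ;
  es_bound : forall x, hin x -> hnorm (es_op x) <= C * hnorm x ;
  es_eigen : forall j, heq (es_op (es_vec j)) ((g (es_val j))%:C *: es_vec j) ;
  es_trace : (nsum (fun j => g (es_val j)) <= t%:E)%E }.

Lemma eigensystem_summable (M : ufmodule R) p C t :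
  eigensystem M (fun l => (1 + l ^+ 2) `^ (- (p / 2))) C t -> summable_for M p.
Proof.
case=> preM J b lam T bb _ Db hT lT bT Tb tr.
have hb j : hin (b j) by exact: bb.1.1.
exists T; split.
  by split; [split => //; exists C | exists J, b, lam].
exists J, b; split => //; apply: le_lt_trans (ltry t); apply: le_trans tr.
apply: le_esum => j _; rewrite lee_fin.
rewrite (heq_hdotl preM (hT _ (hb j)) _ (hb j) (Tb j)); last exact: hinZ.
by rewrite (hdotZl preM) // bb.1.2 eqxx mulr1.
Qed.

Lemma es_op0 (M : ufmodule R) g C t (E : eigensystem M g C t) : heq (es_op E 0) 0.
Proof.
have preM := es_pre E; rewrite /heq subr0; apply/eqP; rewrite eq_le hnorm_ge0 andbT.
by have := es_bound E (hin0 preM); rewrite (hnorm0 preM) mulr0.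
Qed.

Section DirectSum.
Context (I : choiceType) (M : I -> ufmodule R) (g : R -> R) (C : R) (t : I -> R).
Hypothesis g0 : forall l, 0 <= g l.
Hypothesis C0 : 0 <= C.
Hypothesis t0 : forall i, 0 <= t i.
Hypothesis st : (nsum t < +oo)%E.
Context (E : forall i, eigensystem (M i) g C (t i)).

Let preM i : prehilbert (M i) := es_pre (E i).
Let HM : hilbert R := hspace (dirsum M).
Let preHM : prehilbert HM := prehilbert_hsum preM.
Let b := hsum_basis (fun i => @es_vec _ _ _ _ (E i)).
Let T (x : HM) : HM := fun i => es_op (E i) (x i).

Let T_sqr_le (x : HM) : hin x ->
  (nsum (fun i => (hnorm (T x i) ^+ 2)%R) <= (C ^+ 2 * hnorm x ^+ 2)%:E)%E.
Proof.
move=> hx; rewrite EFinM (hsum_hnorm preM hx) -nsumZ ?sqr_ge0 //; last first.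
  by move=> i; exact: sqr_ge0.
apply: le_nsum => i; rewrite -exprMn ler_pXn2r ?nnegrE ?mulr_ge0 ?hnorm_ge0 //.
by apply: es_bound; exact: hx.1.
Qed.

Let hinT (x : HM) : hin x -> hin (T x).
Proof.
move=> hx; split=> [i|]; first by apply: es_hin; exact: hx.1.
exact: le_lt_trans (T_sqr_le hx) (ltry _).
Qed.

Let hinZM a (x : HM) : hin x -> hin (a *: x).
Proof. exact: (hinZ preHM). Qed.

Lemma eigensystem_dirsum : eigensystem (dirsum M) g C (fine (nsum t)).
Proof.
have bb : orthonormal_basis b by apply: hsum_orthonormal_basis => // i; exact: es_basis.
have hv i j : hin (es_vec (e := E i) j) by exact: (es_basis (E i)).1.1.
have hb p : hin (b p) by exact: hin_emb.
apply: (@Eigensystem (dirsum M) g C _ preHM _ b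
  (fun p => es_val (e := E (tag p)) (tagged p)) T bb).
- by split => [||i]; [exact: (hin0 preHM)..|exact: es_dirac0].
- move=> p; split=> [||i]; [exact: hb|exact: hinZM|].
  rewrite -[(_ *: b p) i]/(_ *: (b p) i) /b /hsum_basis.
  case: p => k j /=; have [ki|ik] := eqVneq i k.
    by subst k; rewrite emb_in; exact: es_dirac.
  by rewrite emb_out // scaler0; exact: es_dirac0.
- exact: hinT.
- move=> a x y hx hy; apply: (hsum_heq preM).
  + by apply: hinT; exact: hin_lin.
  + by apply: (hin_lin preHM); exact: hinT.
  + by move=> i; apply: es_lin; [exact: hx.1|exact: hy.1].
- move=> x hx; rewrite -(@ler_pXn2r _ 2%N) ?nnegrE ?mulr_ge0 ?hnorm_ge0 //.
  by rewrite -lee_fin (hsum_hnorm preM (hinT hx)) exprMn; exact: T_sqr_le.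
- move=> p; apply: (hsum_heq preM); [exact: hinT|exact: hinZM|move=> i].
  rewrite -[(_ *: b p) i]/(_ *: (b p) i) /T /b /hsum_basis.
  case: p => k j /=; have [ki|ik] := eqVneq i k.
    by subst k; rewrite emb_in; exact: es_eigen.
  by rewrite emb_out // scaler0; exact: es_op0.
- rewrite fineK ?nsum_fin // nsum_sigT //.
  by apply: le_esum => i _; exact: es_trace.
Qed.

End DirectSum.

(* An eigenvector of the adjoint; unlike [dirac e (mu%:C *: e)] this says which
   eigenvectors of [dirac] are not orthogonal to [e]. *)
Definition weak_eigenvector (M : ufmodule R) (mu : R) (e : M) : Prop :=
  hin e /\ forall x y : M, dirac x y -> hdot y e = mu%:C * hdot x e.

Lemma weak_eigenvector_emb (I : choiceType) (M : I -> ufmodule R) i mu (e : M i) :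
  (forall i, prehilbert (M i)) -> weak_eigenvector mu e ->
  @weak_eigenvector (dirsum M) mu (@emb R I (fun i => hspace (M i)) i e).
Proof.
move=> preM [he eE]; split; first exact: hin_emb.
by move=> x y [hx hy xy]; rewrite !(hdot_emb preM) //; exact: eE.
Qed.

(** Pairing the relation D b = λ b with [e k] in two ways gives λ = [mu k] unless the inner product
    vanishes. This is the hypothesis linking the two families in [trace_le], which bounds every
    finite subsum by the given trace. *)
Lemma summable_for_eigenvalues (M : ufmodule R) (K : choiceType) (e : K -> M)
    (mu : K -> R) (p : R) :
  prehilbert M -> orthonormal e -> (forall k, weak_eigenvector (mu k) (e k)) ->
  summable_for M p ->
  (nsum (fun k => ((1 + mu k ^+ 2) `^ (- (p / 2)))%R) < +oo)%E.
Proof.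
move=> preM oe eE [T [[boT [J [b [lam [bb Db Tb]]]]] [I [a [ba tr]]]]].
pose g l := (1 + l ^+ 2) `^ (- (p / 2)) : R.
have gl0 l : 0 <= g l by exact: powR_ge0.
have key F : uniq F -> ((\sum_(k <- F) g (mu k))%:E <=
    \esum_(i in [set: I]) (Re (hdot (T (a i)) (a i)))%:E)%E.
  move=> uF; apply: (@trace_le R M preM T boT J b bb (fun j => g (lam j))
    (fun j => gl0 _) Tb K e oe (fun k => g (mu k)) (fun k => gl0 _)) => // j k jk.
  have := (eE k).2 _ _ (Db j).
  rewrite (hdotZl preM) ?(eE k).1 //; last 2 first.
  - exact: bb.1.1.
  - exact: (eE k).1.
  by move/(mulIf jk) => -[->].
apply: le_lt_trans tr; apply: ge_ereal_sup => _ [X [finX _] <-].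
by rewrite fsbig_finite //= sumEFin; apply: key; exact: finmap.fset_uniq.
Qed.

End Eigensystems.

(** * Square-integrable functions on a circle *)

Section CircleL2.
Context {R : realType} {r : R} (r0 : 0 < r).
Notation mu := (@lebesgue_measure R).
Notation D := (cball r).
Implicit Types (f g : R -> R).

Lemma measurable_cball : measurable (D : set (measurableTypeR R)).
Proof. exact: measurable_itv. Qed.
Let mD := measurable_cball.

Lemma mu_cball : mu D = (2 * pi * r)%:E.
Proof.
rewrite /cball lebesgue_measure_itv /= lte_fin gt0_cp ?mulr_gt0 ?pi_gt0 //.
by rewrite -EFinB; congr EFin; ring.
Qed.

Lemma cball_gt0 : 0 < 2 * pi * r.
Proof. by rewrite !mulr_gt0 ?pi_gt0. Qed.

Definition integ f : Prop := mu.-integrable D (EFin \o f).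

Definition L2fun f : Prop := measurable_fun D f /\ integ (fun t => f t ^+ 2).

Lemma integP f : integ f <-> measurable_fun D f /\ (\int[mu]_(t in D) `|f t|%:E < +oo)%E.
Proof.
split=> [/integrableP[mf fi]|[mf fi]]; first by split => //; exact/measurable_EFinP.
by apply/integrableP; split => //; exact/measurable_EFinP.
Qed.

Lemma integ_le f g : measurable_fun D f -> integ g ->
  (forall t, D t -> `|f t| <= g t) -> integ f.
Proof.
move=> mf ig fg; apply: (le_integrable mD _ _ ig); first exact/measurable_EFinP.
move=> t Dt /=; rewrite lee_fin; apply: le_trans (fg t Dt) (ler_norm _).
Qed.

Lemma integD f g : integ f -> integ g -> integ (fun t => f t + g t).
Proof. by move=> fi gi; have := integrableD mD fi gi. Qed.

Lemma integZ a f : integ f -> integ (fun t => a * f t).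
Proof. by move=> fi; have := integrableZl mD a fi. Qed.

Lemma integ_cst a : integ (fun=> a).
Proof.
apply/integP; split; first exact: measurable_cst.
by rewrite integral_cst // [X in (_ * X)%E]mu_cball -EFinM ltry.
Qed.

Lemma integ_bounded f M : measurable_fun D f -> (forall t, D t -> `|f t| <= M) -> integ f.
Proof.
by move=> mf fM; apply: (integ_le mf (integ_cst M) fM).
Qed.

Lemma L2fun_mul f g : L2fun f -> L2fun g -> integ (fun t => f t * g t).
Proof.
move=> [mf f2] [mg g2]; apply: (integ_le _ (integD f2 g2)) => [|t _].
  exact: measurable_funM.
rewrite normrM -(real_normK (num_real (f t))) -(real_normK (num_real (g t))).
exact: mulr_le_sqrD.
Qed.

Lemma L2fun_lin a f g : L2fun f -> L2fun g -> L2fun (fun t => a * f t + g t).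
Proof.
move=> Lf Lg; have [mf f2] := Lf; have [mg g2] := Lg.
have m : measurable_fun D (fun t => a * f t + g t).
  by apply: measurable_funD => //; exact: measurable_funM.
split => //.
have := integD (integD (integZ (a ^+ 2) f2) (integZ (2 * a) (L2fun_mul Lf Lg))) g2.
by congr integ; apply/funext => t; ring.
Qed.

Lemma hin_L2 (x : L2 r) : hin x <->
  L2fun (fun t => Re (x t)) /\ L2fun (fun t => Im (x t)).
Proof.
split.
  move=> [mr mi fi].
  have mr2 : measurable_fun D (fun t => Re (x t) ^+ 2) by exact: measurable_funX.
  have mi2 : measurable_fun D (fun t => Im (x t) ^+ 2) by exact: measurable_funX.
  have I : integ (fun t => Re (x t) ^+ 2 + Im (x t) ^+ 2).
    apply/integP; split; first exact: measurable_funD.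
    apply: le_lt_trans fi; rewrite le_eqVlt; apply/orP; left; apply/eqP.
    by apply: eq_integral => t _; rewrite ger0_norm // addr_ge0 ?sqr_ge0.
  split; split => //; apply: (integ_le _ I) => // t _.
    by rewrite ger0_norm ?sqr_ge0 // lerDl sqr_ge0.
  by rewrite ger0_norm ?sqr_ge0 // lerDr sqr_ge0.
move=> [[mr r2] [mi i2]]; split => //.
have /integP[_] := integD r2 i2; apply: le_lt_trans.
rewrite le_eqVlt; apply/orP; left; apply/eqP.
by apply: eq_integral => t _; rewrite ger0_norm // addr_ge0 ?sqr_ge0.
Qed.

Definition cinteg (u : R -> R[i]) : Prop :=
  integ (fun t => Re (u t)) /\ integ (fun t => Im (u t)).

Lemma cmeanD u v : cinteg u -> cinteg v ->
  cmean r (fun t => u t + v t) = cmean r u + cmean r v.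
Proof.
move=> [ur ui] [vr vi]; apply: complex_eqP; rewrite ?Re_add ?Im_add /= -mulrDr;
  congr (_ * _); rewrite -RintegralD //; apply: eq_Rintegral => t _.
  by rewrite Re_add.
by rewrite Im_add.
Qed.

Lemma cintegZ a u : cinteg u -> cinteg (fun t => a * u t).
Proof.
move=> [ur ui]; split.
  have := integD (integZ (Re a) ur) (integZ (- Im a) ui).
  by congr integ; apply/funext => t; rewrite Re_mul; ring.
have := integD (integZ (Re a) ui) (integZ (Im a) ur).
by congr integ; apply/funext => t; rewrite Im_mul; ring.
Qed.

Lemma cmeanZ a u : cinteg u -> cmean r (fun t => a * u t) = a * cmean r u.
Proof.
move=> [ur ui]; apply: complex_eqP; rewrite ?Re_mul ?Im_mul /=.
  rewrite [RHS](_ : _ = (2 * pi * r)^-1 * (Re a * \int[mu]_(t in D) Re (u t)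
      + (- Im a) * \int[mu]_(t in D) Im (u t))); last by ring.
  congr (_ * _); rewrite -!RintegralZl // -RintegralD //; try exact: integZ.
  by apply: eq_Rintegral => t _; rewrite Re_mul; ring.
rewrite [RHS](_ : _ = (2 * pi * r)^-1 * (Re a * \int[mu]_(t in D) Im (u t)
    + Im a * \int[mu]_(t in D) Re (u t))); last by ring.
congr (_ * _); rewrite -!RintegralZl // -RintegralD //; try exact: integZ.
by apply: eq_Rintegral => t _; rewrite Im_mul; ring.
Qed.

Lemma hdot_L2E (x y : L2 r) : hdot x y = cmean r (fun t => x t * conjc (y t)).
Proof. by []. Qed.

Lemma hin_cinteg (x y : L2 r) : hin x -> hin y -> cinteg (fun t => x t * conjc (y t)).
Proof.
move=> /hin_L2[xr xi] /hin_L2[yr yi]; split.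
  have := integD (L2fun_mul xr yr) (L2fun_mul xi yi).
  by congr integ; apply/funext => t; rewrite !ReImE; ring.
have := integD (L2fun_mul xi yr) (integZ (-1) (L2fun_mul xr yi)).
by congr integ; apply/funext => t; rewrite !ReImE; ring.
Qed.

Lemma prehilbert_L2 : prehilbert (L2 r).
Proof.
split.
- apply/hin_L2; split; (split; first exact: measurable_cst);
  by apply: (@integ_bounded _ 0) => [|t _] /=; rewrite ?expr0n ?normr0 //;
    exact: measurable_cst.
- move=> a x y /hin_L2[xr xi] /hin_L2[yr yi]; apply/hin_L2; split.
    have := L2fun_lin (Re a) xr (L2fun_lin (- Im a) xi yr).
    by congr L2fun; apply/funext => t; rewrite -[(_ + y) t]/(a * x t + y t) !ReImE; ring.
  have := L2fun_lin (Re a) xi (L2fun_lin (Im a) xr yi).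
  by congr L2fun; apply/funext => t; rewrite -[(_ + y) t]/(a * x t + y t) !ReImE; ring.
- move=> a x y z hx hy hz; rewrite !hdot_L2E.
  have xz := hin_cinteg hx hz; have yz := hin_cinteg hy hz.
  rewrite -cmeanZ // -cmeanD //; last exact: cintegZ.
  by congr cmean; apply/funext => t; rewrite -[(_ + y) t]/(a * x t + y t) mulrDl mulrA.
- move=> x y hx hy; rewrite !hdot_L2E.
  have [_ xi] := hin_cinteg hx hy.
  apply: complex_eqP; rewrite ?Re_conjc ?Im_conjc /=.
    congr (_ * _); apply: eq_Rintegral => t _; rewrite !ReImE; ring.
  rewrite -mulrN -[X in _ = _ * X]mulN1r; congr (_ * _); rewrite -RintegralZl //.
  by apply: eq_Rintegral => t _; rewrite !ReImE; ring.
- move=> x hx; rewrite hdot_L2E /=; apply: mulr_ge0.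
    by rewrite invr_ge0 ltW // cball_gt0.
  apply: Rintegral_ge0 => t _; rewrite mul_conj; exact: nsq_ge0.
Qed.

Lemma sqr_hnorm_L2 (x : L2 r) : hin x ->
  hnorm x ^+ 2 = (2 * pi * r)^-1 * \int[mu]_(t in D) nsq (x t).
Proof.
move=> hx; rewrite (sqr_hnorm prehilbert_L2 hx) hdot_L2E /=; congr (_ * _).
by apply: eq_Rintegral => t _; rewrite mul_conj.
Qed.

Lemma hin_bounded (x : L2 r) M : measurable_fun D (fun t => Re (x t)) ->
  measurable_fun D (fun t => Im (x t)) ->
  (forall t, D t -> nsq (x t) <= M) -> hin x.
Proof.
move=> mr mi xM; apply/hin_L2; split; split => //.
  apply: (@integ_bounded _ M) => [|t Dt]; first exact: measurable_funX.
  by rewrite ger0_norm ?sqr_ge0 // (le_trans (sqr_Re_le _)) // xM.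
apply: (@integ_bounded _ M) => [|t Dt]; first exact: measurable_funX.
by rewrite ger0_norm ?sqr_ge0 // (le_trans (sqr_Im_le _)) // xM.
Qed.

Lemma hnorm_bounded (x : L2 r) M : hin x -> 0 <= M ->
  (forall t, D t -> nsq (x t) <= M ^+ 2) -> hnorm x <= M.
Proof.
move=> hx M0 xM; rewrite -(@ler_pXn2r _ 2%N) ?nnegrE ?hnorm_ge0 //.
rewrite sqr_hnorm_L2 // mulrC ler_pdivrMr ?cball_gt0 //.
have -> : 2 * pi * r = fine (mu D) by rewrite mu_cball.
rewrite -Rintegral_cst //; apply: le_Rintegral => //.
- have /hin_L2[[_ rr] [_ ri]] := hx; exact: integD.
- exact: integ_cst.
Qed.

End CircleL2.

Lemma Rintegral_FTC (R : realType) (f F : R -> R) (a b : R) : a < b ->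
  continuous f -> (forall x : R, is_derive x 1 F (f x)) ->
  \int[@lebesgue_measure R]_(t in `[a, b]) f t = F b - F a.
Proof.
move=> ab cf dF; have cF (x : R) : {for x, continuous F}.
  by apply: differentiable_continuous; apply/derivable1_diffP; have dFx := dF x; exact: ex_derive.
rewrite /Rintegral (@continuous_FTC2 _ f F) //.
- exact: continuous_subspaceT.
- split; [by move=> x _; have dFx := dF x; exact: ex_derive| |].
  + by apply: cvg_at_right_filter; exact: cF.
  + by apply: cvg_at_left_filter; exact: cF.
- move=> x _; rewrite derive1E; have dFx := dF x; exact: derive_val.
Qed.

Lemma sin_natmul_pi (R : realType) n : sin (n%:R * pi) = 0 :> R.
Proof.
elim: n => [|n IH]; first by rewrite mul0r sin0.
by rewrite -natr1 mulrDl mul1r sinDpi IH oppr0.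
Qed.

Lemma sin_intmul_pi (R : realType) (n : int) : sin (n%:~R * pi) = 0 :> R.
Proof.
case: n => n; first exact: sin_natmul_pi.
by rewrite NegzE mulrNz mulNr sinN sin_natmul_pi oppr0.
Qed.

(** * Orthonormality of the trigonometric system and its Dirac eigenvalues *)

Section Fourier.
Context {R : realType} {r : R} (r0 : 0 < r).
Notation mu := (@lebesgue_measure R).
Notation D := (cball r).
Notation e := (@fourier R r).
Implicit Types (k l n : int).

Lemma Re_fourier l t : Re (e l t) = cos (l%:~R * t / r). Proof. by []. Qed.
Lemma Im_fourier l t : Im (e l t) = sin (l%:~R * t / r). Proof. by []. Qed.

Lemma nsq_fourier l t : nsq (e l t) = 1.
Proof. by rewrite /nsq Re_fourier Im_fourier cos2Dsin2. Qed.

Lemma fourier_mul_conj k l t : e k t * conjc (e l t) = e (k - l) t.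
Proof.
apply: complex_eqP; rewrite !ReImE !Re_fourier !Im_fourier intrB !mulrBl.
  by rewrite cosB; ring.
by rewrite sinB; ring.
Qed.

Lemma fourier_mul k l t : e k t * e l t = e (k + l) t.
Proof.
apply: complex_eqP; rewrite !ReImE !Re_fourier !Im_fourier intrD !mulrDl.
  by rewrite cosD; ring.
by rewrite sinD; ring.
Qed.

Lemma continuous_Re_fourier l : continuous (fun t : R => Re (e l t)).
Proof.
move=> t; apply: (@cvg_comp _ _ _ (fun t : R => l%:~R * t / r) cos); last exact: continuous_cos.
by apply: cvgMr_tmp; apply: cvgMl_tmp; exact: cvg_id.
Qed.

Lemma continuous_Im_fourier l : continuous (fun t : R => Im (e l t)).
Proof.
move=> t; apply: (@cvg_comp _ _ _ (fun t : R => l%:~R * t / r) sin); last exact: continuous_sin.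
by apply: cvgMr_tmp; apply: cvgMl_tmp; exact: cvg_id.
Qed.

Lemma measurable_continuous (f : R -> R) : continuous f -> measurable_fun D f.
Proof.
move=> cf; apply: subspace_continuous_measurable_fun; first exact: measurable_cball.
exact: continuous_subspaceT.
Qed.

Lemma hin_fourier l : hin (e l).
Proof.
apply: (hin_bounded r0 (M := 1)).
- by apply: measurable_continuous; exact: continuous_Re_fourier.
- by apply: measurable_continuous; exact: continuous_Im_fourier.
- by move=> t _; rewrite nsq_fourier.
Qed.

(** For nonzero n and a = n/r the antiderivatives are sin(at)/a and -cos(at)/a. At the ends of the
    interval the argument is plus or minus nπ, where the sine vanishes and the cosine takes equal
    values. *)
Lemma cmean_fourier n : cmean r (e n) = (n == 0)%:R.
Proof.
have lt : - (pi * r) < pi * r by rewrite gt0_cp // mulr_gt0 ?pi_gt0.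
have [->|n0] := eqVneq n 0.
  have E t : e 0 t = 1.
    by apply: complex_eqP; rewrite ?Re_fourier ?Im_fourier !mul0r ?cos0 ?sin0.
  rewrite /cmean (eq_Rintegral _ (g := fun=> 1)); last by move=> t _; rewrite E.
  rewrite (eq_Rintegral _ (f := fun t => Im _) (g := fun=> 0)); last by move=> t _; rewrite E.
  rewrite !Rintegral_cst ?mul1r ?mul0r ?mulr0; try exact: measurable_cball.
  rewrite [X in fine X](mu_cball r0) /= mulVf //.
  by rewrite gt_eqF // cball_gt0.
have a0 : n%:~R / r != 0 :> R by rewrite mulf_neq0 ?intr_eq0 // invr_eq0 gt_eqF.
set a := n%:~R / r in a0.
have fE (t : R) : n%:~R * t / r = a * t by rewrite mulrAC.
have aE : a * (pi * r) = n%:~R * pi by rewrite /a; field; rewrite gt_eqF.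
have da (t : R) : is_derive t 1 ( *%R a) a.
  by apply: is_derive_eq; rewrite /GRing.scale /= ?mulr1.
have ds (t : R) : is_derive t 1 (a^-1 \*o (sin \o *%R a)) (Re (e n t)).
  by apply: is_derive_eq; rewrite Re_fourier fE /GRing.scale /=; field.
have dc (t : R) : is_derive t 1 ((- a^-1) \*o (cos \o *%R a)) (Im (e n t)).
  by apply: is_derive_eq; rewrite Im_fourier fE /GRing.scale /=; field.
have I1 : \int[mu]_(t in D) Re (e n t) = 0.
  rewrite (Rintegral_FTC lt (@continuous_Re_fourier n) ds) /=.
  by rewrite mulrN sinN aE sin_intmul_pi oppr0 !mulr0 subr0.
have I2 : \int[mu]_(t in D) Im (e n t) = 0.
  rewrite (Rintegral_FTC lt (@continuous_Im_fourier n) dc) /=.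
  by rewrite mulrN cosN subrr.
by rewrite /cmean I1 I2 mulr0.
Qed.

Lemma hdot_fourier k l : hdot (e k) (e l) = (k == l)%:R.
Proof.
rewrite hdot_L2E -[k == l]subr_eq0 -cmean_fourier; congr cmean.
by apply/funext => t; rewrite fourier_mul_conj.
Qed.

Lemma fourier_orthonormal : orthonormal e.
Proof. by split; [exact: hin_fourier|exact: hdot_fourier]. Qed.

Lemma fourier_dirac l : circle_dirac (e l) (((l%:~R + 1 / 2) / r)%:C *: e l).
Proof.
split; [exact: hin_fourier|apply: (hinZ (prehilbert_L2 r0)); exact: hin_fourier|].
move=> k; rewrite (hdotZl (prehilbert_L2 r0)); try exact: hin_fourier.
by rewrite hdot_fourier; case: eqP => [->//|_]; rewrite !mulr0.
Qed.

Lemma circle_dirac0 : circle_dirac (0 : L2 r) 0.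
Proof.
have h0 := hin0 (prehilbert_L2 r0).
split => // l; rewrite (hdot0l (prehilbert_L2 r0)) ?mulr0 //; exact: hin_fourier.
Qed.

(** [circle_dirac] is defined by its pairings with exactly these functions, so nothing about the
    pair x, y has to be computed. *)
Lemma fourier_weak_eigenvector c l :
  @weak_eigenvector R (curve_module r c) ((l%:~R + 1 / 2) / r) (e l).
Proof. by split; [exact: hin_fourier|move=> x y [_ _ ->]]. Qed.

End Fourier.

(** * Completeness of the trigonometric system *)

Section SpanClosure.
Context {R : realType} {H : hilbert R} (preH : prehilbert H).
Context {J : choiceType} {b : J -> H} (hb : forall j, hin (b j)).
Implicit Types (x y v : H).

(** Pairs of an index and a coefficient, with repetitions allowed, make sums a concatenation of
    lists and products a list of pairs. [in_spanE] collects equal indices to return to the form used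
    in [orthonormal_basis]. *)
Definition in_span v : Prop :=
  exists s : seq (J * R[i]), v = \sum_(p <- s) p.2 *: b p.1.

Definition in_closed_span x : Prop :=
  hin x /\ forall eps : R, 0 < eps -> exists2 v, in_span v & hnorm (x - v) < eps.

Lemma in_span_hin v : in_span v -> hin v.
Proof. by case=> s ->; apply: (hin_sum preH) => p; apply: hinZ. Qed.

Lemma in_spanZ a v : in_span v -> in_span (a *: v).
Proof.
case=> s ->; exists [seq (p.1, a * p.2) | p <- s]; rewrite big_map scaler_sumr.
by apply: eq_bigr => p _; rewrite scalerA.
Qed.

Lemma in_spanD v w : in_span v -> in_span w -> in_span (v + w).
Proof. by move=> [s ->] [t ->]; exists (s ++ t); rewrite big_cat. Qed.

Lemma in_spanE v : in_span v -> exists (s : seq J) (c : J -> R[i]),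
  v = \sum_(j <- s) c j *: b j.
Proof.
case=> s ->; exists (undup (map fst s)), (fun j => \sum_(p <- s | p.1 == j) p.2).
under [RHS]eq_bigr do rewrite scaler_suml.
rewrite (exchange_big_dep predT) //= [LHS]big_seq [RHS]big_seq.
apply: eq_bigr => p ps.
have pu : p.1 \in undup (map fst s) by rewrite mem_undup map_f.
rewrite big_mkcond (bigD1_seq p.1) ?undup_uniq //= eqxx big1 ?addr0 // => j.
by rewrite eq_sym => /negPf ->.
Qed.

Lemma closed_span_basis : orthonormal b -> (forall x, hin x -> in_closed_span x) ->
  orthonormal_basis b.
Proof.
move=> ob cl; split => // x hx e e0; have [_ /(_ e e0)[v vs ve]] := cl x hx.
by have [s [c vE]] := in_spanE vs; exists s, c; rewrite -vE.
Qed.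

Lemma in_span_closed v : in_span v -> in_closed_span v.
Proof.
move=> sv; split=> [|e e0]; first exact: in_span_hin.
by exists v; rewrite // subrr (hnorm0 preH).
Qed.

Lemma in_closed_span_lin a x y : in_closed_span x -> in_closed_span y ->
  in_closed_span (a *: x + y).
Proof.
move=> [hx cx] [hy cy]; split=> [|e e0]; first exact: (hin_lin preH).
set k := Num.sqrt (nsq a); have k0 : 0 <= k by exact: sqrtr_ge0.
(* The denominator is k + 1 rather than k, so that a = 0 needs no separate treatment. *)
have d0 : 0 < e / (k + 1) by rewrite divr_gt0 // ltr_wpDl.
have e20 : 0 < e / (k + 1) / 2 by rewrite divr_gt0.
have [v sv xv] := cx _ e20; have [w sw yw] := cy _ e20.
have hv := in_span_hin sv; have hw := in_span_hin sw.
exists (a *: v + w); first by apply: in_spanD => //; exact: in_spanZ.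
have -> : a *: x + y - (a *: v + w) = a *: (x - v) + (y - w).
  by rewrite opprD addrACA scalerBr.
have hxv := hinB preH hx hv; have hyw := hinB preH hy hw.
apply: le_lt_trans (hnormD preH (hinZ preH a hxv) hyw) _.
rewrite (hnormZ preH) // -/k.
apply: (@le_lt_trans _ _ ((k + 1) * (e / (k + 1) / 2))).
  rewrite mulrDl mul1r lerD ?ler_wpM2l // ltW //.
have -> : (k + 1) * (e / (k + 1) / 2) = e / 2 by field; rewrite gt_eqF // ltr_wpDl.
lra.
Qed.

Lemma in_closed_span0 : in_closed_span 0.
Proof. by apply: in_span_closed; exists [::]; rewrite big_nil. Qed.

Lemma in_closed_span_lim x : hin x ->
  (forall e : R, 0 < e -> exists2 y, in_closed_span y & hnorm (x - y) < e) ->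
  in_closed_span x.
Proof.
move=> hx cl; split => // e e0; have e20 : 0 < e / 2 by rewrite divr_gt0.
have [y [hy cy] xy] := cl _ e20; have [v sv yv] := cy _ e20.
have hv := in_span_hin sv.
exists v => //; rewrite -[x - v](subrKA y).
apply: le_lt_trans (hnormD preH (hinB preH hx hy) (hinB preH hy hv)) _; lra.
Qed.

End SpanClosure.

(** * Polynomial approximation of a jump *)

Section SignIteration.
Context {R : realType}.
Implicit Types (x q : R).

Definition sign_step x : R := (3 * x - x ^+ 3) / 2.

(* On [-1, 1] the iterates of x |-> (3 x - x^3)/2 converge to the sign of x, hence
   these polynomials converge to the indicator function of x > 0. *)
Definition pos_approx n q : R :=
  (iter n sign_step q + iter n sign_step q ^+ 2) / 2.

Lemma sign_step_opp x : sign_step (- x) = - sign_step x.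
Proof. by rewrite /sign_step; field. Qed.

Lemma iter_sign_step_opp n q : iter n sign_step (- q) = - iter n sign_step q.
Proof. by elim: n => //= n ->; rewrite sign_step_opp. Qed.

(** On (0, 1] one step increases s by s(1 - s)(1 + s)/2 and leaves the distance (1 - s)²(2 + s)/2 to
    1; both quantities are nonnegative. *)
Lemma iter_sign_step_itv n q : 0 < q <= 1 -> q <= iter n sign_step q <= 1.
Proof.
move=> /andP[q0 q1]; elim: n => [|n /=]; first by rewrite /= lexx q1.
move: (iter n sign_step q) => s /andP[qs s1].
have s0 : 0 < s := lt_le_trans q0 qs.
have a : 0 <= s * (1 - s) * (1 + s) by rewrite !mulr_ge0 //; lra.
have b : 0 <= (1 - s) ^+ 2 * (2 + s) by rewrite mulr_ge0 ?sqr_ge0 //; lra.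
have aE : sign_step s = s + s * (1 - s) * (1 + s) / 2 by rewrite /sign_step; field.
have bE : sign_step s = 1 - (1 - s) ^+ 2 * (2 + s) / 2 by rewrite /sign_step; field.
apply/andP; split; first by rewrite aE; lra.
by rewrite bE; lra.
Qed.

(** One step multiplies the distance to 1 by 1 - s(1 + s)/2, which is at most 1 - q/2 because the
    iterates stay above q. *)
Lemma iter_sign_step_geometric n q : 0 < q <= 1 ->
  1 - iter n sign_step q <= (1 - q / 2) ^+ n.
Proof.
move=> q01; have /andP[q0 q1] := q01; elim: n => [|n IH]; first by rewrite /= expr0; lra.
have := iter_sign_step_itv n q01; rewrite exprS /=; move: IH.
move: (iter n sign_step q) => s IH /andP[qs s1].
have -> : 1 - sign_step s = (1 - s * (1 + s) / 2) * (1 - s) by rewrite /sign_step; field.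
have ss : q <= s * (1 + s).
  by rewrite mulrDr mulr1 -expr2; have := sqr_ge0 s; lra.
have s2 : s * (1 + s) <= 2.
  by apply: (@le_trans _ _ (1 * 2)); [apply: ler_pM; lra|lra].
by apply: ler_pM => //; lra.
Qed.

Lemma iter_sign_step_cvg q : 0 < q <= 1 -> iter n sign_step q @[n --> \oo] --> (1 : R).
Proof.
move=> q01; have /andP[q0 q1] := q01.
apply: (@squeeze_cvgr _ _ _ _ (fun n => 1 - (1 - q / 2) ^+ n) (fun=> 1)).
- near=> n; have /andP[_ ->] := iter_sign_step_itv n q01; rewrite andbT.
  by have := iter_sign_step_geometric n q01; lra.
- rewrite -[X in _ --> X]subr0; apply: cvgB; first exact: cvg_cst.
  by apply: cvg_expr; rewrite ger0_norm; lra.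
- exact: cvg_cst.
Unshelve. all: end_near. Qed.

(** The iterates converge to the sign of q, and s ↦ (s + s²)/2 sends -1, 0, 1 to 0, 0, 1. *)
Lemma pos_approx_cvg q : -1 <= q <= 1 ->
  pos_approx n q @[n --> \oo] --> ((0 < q)%R%:R : R).
Proof.
have F (u : nat -> R) (l : R) : u n @[n --> \oo] --> l ->
    (u n + u n ^+ 2) / 2 @[n --> \oo] --> (l + l ^+ 2) / 2.
  by move=> ul; apply: cvgMr_tmp; apply: cvgD => //; rewrite expr2; apply: cvgM.
move=> /andP[q1 q2]; rewrite /pos_approx; have [q0|q0|->] := ltgtP q 0.
- have : iter n sign_step q @[n --> \oo] --> (-1 : R).
    rewrite (_ : (fun n => _) = fun n => - iter n sign_step (- q)); last first.
      by apply/funext => n; rewrite iter_sign_step_opp opprK.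
    by apply: cvgN; apply: iter_sign_step_cvg; lra.
  by move/F; rewrite expr2 mulrNN mul1r addNr mul0r.
- have : iter n sign_step q @[n --> \oo] --> (1 : R) by apply: iter_sign_step_cvg; lra.
  by move/F; rewrite expr1n; have -> : (1 + 1) / 2 = 1 :> R by field.
- have : iter n sign_step (0 : R) @[n --> \oo] --> (0 : R).
    have E n : iter n sign_step 0 = 0.
      by elim: n => //= n ->; rewrite /sign_step mulr0 expr0n subr0 mul0r.
    by rewrite (_ : (fun n => _) = fun=> 0); [exact: cvg_cst|apply/funext => n; exact: E].
  by move/F; rewrite expr0n addr0 mul0r.
Qed.

(** Completing the square in (s + s²)/2 bounds it below, uniformly in n; this is the domination
    under which the approximations converge in L². *)
Lemma pos_approx_itv n q : -1 <= q <= 1 -> 0 <= pos_approx n q + 1 / 2 /\ pos_approx n q <= 1.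
Proof.
move=> /andP[q1 q2].
have : -1 <= iter n sign_step q <= 1.
  have [q0|q0|->] := ltgtP q 0.
  - rewrite -[q]opprK iter_sign_step_opp; have nq : 0 < - q <= 1 by lra.
    by have := iter_sign_step_itv n nq; lra.
  - have nq : 0 < q <= 1 by lra.
    by have := iter_sign_step_itv n nq; lra.
  - have -> : iter n sign_step 0 = 0 by elim: n => //= n ->; rewrite /sign_step; field.
    lra.
rewrite /pos_approx; move: (iter n _ _) => s /andP[s1 s2].
have : 0 <= (1 - s) * (1 + s) by rewrite mulr_ge0; lra.
by have := sqr_ge0 (s + 1 / 2); rewrite sqrrD; split; lra.
Qed.

End SignIteration.

Section TrigonometricPolynomials.
Context {R : realType} {r : R}.
Notation e := (@fourier R r).

Definition cfct (f : R -> R) : L2 r := (fun t => (f t)%:C) : R -> R[i].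

Definition trig_poly (f : R -> R) : Prop := in_span (b := e) (cfct f).

Lemma span_fourier_apply (s : seq (int * R[i])) t :
  (\sum_(p <- s) p.2 *: e p.1 : L2 r) t = \sum_(p <- s) p.2 * e p.1 t.
Proof.
elim: s => [|p s IH]; first by rewrite !big_nil.
by rewrite !big_cons -IH.
Qed.

(** Frequencies add under multiplication, so the span is an algebra, and a polynomial in a
    trigonometric polynomial is again one. *)
Lemma in_span_mul (x y : L2 r) : in_span (b := e) x -> in_span (b := e) y ->
  in_span (b := e) ((fun t => x t * y t) : L2 r).
Proof.
move=> [s ->] [u ->]; exists [seq (p.1 + q.1, p.2 * q.2) | p <- s, q <- u].
apply/funext => t; rewrite !span_fourier_apply big_allpairs_dep big_distrlr /=.
apply: eq_bigr => p _; apply: eq_bigr => q _; rewrite -fourier_mul; ring.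
Qed.

Lemma trig_polyM f g : trig_poly f -> trig_poly g -> trig_poly (fun t => f t * g t).
Proof.
move=> tf tg; have := in_span_mul tf tg; congr in_span.
by apply/funext => t; rewrite /cfct rmorphM.
Qed.

Lemma trig_polyD f g : trig_poly f -> trig_poly g -> trig_poly (fun t => f t + g t).
Proof.
move=> tf tg; have := in_spanD tf tg; congr in_span.
by apply/funext => t; rewrite /cfct rmorphD.
Qed.

Lemma trig_poly_cst a : trig_poly (fun=> a).
Proof.
exists [:: (0, a%:C)]; rewrite big_seq1; apply/funext => t.
rewrite /cfct -[RHS]/(a%:C * e 0 t).
by apply: complex_eqP; rewrite !ReImE !Re_fourier !Im_fourier !mul0r ?cos0 ?sin0 /=; ring.
Qed.

Lemma trig_poly_cos m : trig_poly (fun t => cos ((t - m) / r)).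
Proof.
(* Euler's formula for the cosine, the phase m being carried by the coefficients. *)
exists [:: (1, (1 / 2)%:C * conjc (e 1 m)); (-1, (1 / 2)%:C * e 1 m)].
rewrite big_cons big_seq1; apply/funext => t.
rewrite /cfct -[RHS]/((1 / 2)%:C * conjc (e 1 m) * e 1 t + (1 / 2)%:C * e 1 m * e (-1) t).
have cE : (-1)%:~R * t / r = - (t / r) :> R by rewrite mulN1r mulNr.
apply: complex_eqP; rewrite !ReImE !Re_fourier !Im_fourier /= cE cosN sinN !mul1r.
  by rewrite mulrBl cosB; field.
by field.
Qed.

Lemma trig_poly_pos_approx n f : trig_poly f -> trig_poly (fun t => pos_approx n (f t)).
Proof.
move=> tf; have ti : trig_poly (fun t => iter n sign_step (f t)).
  elim: n => [//|n IH].
  have := trig_polyM (trig_poly_cst (1 / 2)) (trig_polyD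
    (trig_polyM (trig_poly_cst 3) IH)
    (trig_polyM (trig_poly_cst (-1)) (trig_polyM IH (trig_polyM IH IH)))).
  by congr trig_poly; apply/funext => t; rewrite /= /sign_step; field.
have := trig_polyM (trig_poly_cst (1 / 2)) (trig_polyD ti (trig_polyM ti ti)).
by congr trig_poly; apply/funext => t; rewrite /pos_approx; field.
Qed.

End TrigonometricPolynomials.
Arguments cfct {R} r f.
Arguments trig_poly {R} r f.

Section FourierCompleteness.
Context {R : realType} {r : R} (r0 : 0 < r).
Notation mu := (@lebesgue_measure R).
Notation D := (cball r).
Notation e := (@fourier R r).
Let preL := prehilbert_L2 r0.
Let mD := measurable_cball (r := r).
Let he := hin_fourier r0.

Definition trig_approx (f : R -> R) : Prop := in_closed_span (b := e) (cfct r f).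

Lemma hin_cfct f : L2fun (r := r) f -> hin (cfct r f).
Proof.
move=> Lf; apply/hin_L2; split => //=.
split; first exact: measurable_cst.
by rewrite expr0n; exact: integ_cst.
Qed.

Lemma cfct_hin f : hin (cfct r f) -> L2fun (r := r) f.
Proof. by move/hin_L2 => -[]. Qed.

Lemma trig_approx_lin a f g : trig_approx f -> trig_approx g ->
  trig_approx (fun t => a * f t + g t).
Proof.
move=> tf tg; have := in_closed_span_lin preL he a%:C tf tg.
congr in_closed_span; apply/funext => t.
by rewrite /cfct rmorphD rmorphM.
Qed.

Lemma trig_approx0 : trig_approx (fun=> 0).
Proof. exact: (in_closed_span0 preL he). Qed.

Lemma trig_approx_sum (I : Type) (s : seq I) (c : I -> R) (F : I -> R -> R) :
  (forall i, trig_approx (F i)) -> trig_approx (fun t => \sum_(i <- s) c i * F i t).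
Proof.
move=> tF; elim: s => [|i s IH].
  by have := trig_approx0; congr trig_approx; apply/funext => t; rewrite big_nil.
have := trig_approx_lin (c i) (tF i) IH.
by congr trig_approx; apply/funext => t; rewrite big_cons.
Qed.

Lemma trig_approx_poly f : trig_poly r f -> trig_approx f.
Proof. exact: (in_span_closed preL he). Qed.

Lemma negligible_cball_boundary : mu.-negligible [set - (pi * r); pi * r].
Proof.
exists [set - (pi * r); pi * r]; split => //.
  by apply: measurableU; exact: measurable_set1.
apply: countable_lebesgue_measure0; apply: finite_set_countable.
exact: finite_set2.
Qed.

(* Nothing is asked at the endpoints of [D], where trigonometric polynomials agree. *)
Lemma trig_approx_dominated (f_ : nat -> R -> R) (f g : R -> R) :
  (forall n, trig_approx (f_ n)) -> measurable_fun D f ->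
  (forall t, - (pi * r) < t < pi * r -> f_ n t @[n --> \oo] --> f t) ->
  integ (r := r) g -> (forall n t, D t -> (f_ n t - f t) ^+ 2 <= g t) ->
  trig_approx f.
Proof.
move=> tf mf ff ig fg.
have Lf_ n : L2fun (r := r) (f_ n) by exact: cfct_hin (tf n).1.
have Ld n : L2fun (r := r) (fun t => f_ n t - f t).
  have m : measurable_fun D (fun t => f_ n t - f t).
    by apply: measurable_funB => //; exact: (Lf_ n).1.
  split => //; apply: (integ_le _ ig) => [|t Dt]; first exact: measurable_funX.
  by rewrite ger0_norm ?sqr_ge0 // fg.
(* f is recovered from one approximant and its difference to f, both square-integrable. *)
have Lf : L2fun (r := r) f.
  have := L2fun_lin (-1) (Ld 0%N) (Lf_ 0%N).
  by congr L2fun; apply/funext => t; ring.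
apply: (in_closed_span_lim preL he); first exact: hin_cfct.
move=> eps eps0.
have aecvg : \forall t \ae mu, D t ->
    ((f_ n t - f t) ^+ 2)%:E @[n --> \oo] --> (0%E : \bar R).
  apply: negligibleS negligible_cball_boundary => t /=.
  apply: contra_notP => /not_orP[t1 t2] Dt.
  have : - (pi * r) < t < pi * r.
    move: Dt; rewrite /cball /= in_itv /= => /andP[a b].
    by rewrite !lt_neqAle a b !andbT; apply/andP; split; apply/eqP => // E; apply: t1.
  move/ff => fft; apply/fine_cvgP; split; first exact: nearW.
  rewrite -[X in _ --> X](expr0n R 2) expr2 -(subrr (f t)).
  by rewrite [X in X @ _ --> _](_ : _ = fun n => (f_ n t - f t) * (f_ n t - f t)) //;
    apply: cvgM; apply: cvgB => //; exact: cvg_cst.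
have aedom : \forall t \ae mu, forall n : nat, D t ->
    (`|((f_ n t - f t) ^+ 2)%:E| <= (EFin \o g) t)%E.
  by apply: aeW => t n Dt; rewrite /= lee_fin ger0_norm ?sqr_ge0 // fg.
have [_ _] := dominated_convergence mD
  (fun n => (measurable_EFinP _ _).2 (measurable_funX 2 (Ld n).1))
  (measurable_cst _) aecvg ig aedom.
rewrite integral0 => /fine_cvg /cvgrPdist_lt.
have ep : 0 < 2 * pi * r * eps ^+ 2 by rewrite mulr_gt0 ?cball_gt0 // exprn_gt0.
move=> /(_ _ ep) [N _ /(_ N (leqnn N))].
rewrite sub0r normrN /= -/(Rintegral _ _ _) => Neps.
exists (cfct r (f_ N)); first exact: tf.
have hf : hin (cfct r f) by exact: hin_cfct.
have hfN : hin (cfct r (f_ N)) by exact: (tf N).1.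
have hE := sqr_hnorm_L2 r0 (hinB preL hf hfN).
rewrite [X in _ * X](_ : _ = \int[mu]_(t in D) ((f_ N t - f t) ^+ 2)) in hE; last first.
  apply: eq_Rintegral => t _; rewrite -[(cfct r f - cfct r (f_ N)) t]/((f t)%:C - (f_ N t)%:C).
  by rewrite -rmorphB nsqR -sqrrN opprB.
rewrite -(@ltr_pXn2r _ 2%N) ?nnegrE ?hnorm_ge0 ?ltW // hE.
rewrite mulrC ltr_pdivrMr ?cball_gt0 // mulrC.
exact: le_lt_trans (ler_norm _) Neps.
Qed.

End FourierCompleteness.

(** The range of u is one full period of the cosine, cut at the right end h of the arc |u| < h, so
    that only the left end of the arc is visible. Outside the arc v = -u lies in [h, 2π - h]; the
    reflection v ↦ 2π - v brings it into [0, π], where the cosine decreases. *)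
Lemma cos_lt_arc (R : realType) (h u : R) : 0 < h < pi -> - (2 * pi - h) < u < h ->
  (cos h < cos u) = (- h < u).
Proof.
move=> /andP[h0 hp] /andP[u1 u2].
have hI : h \in `[0, pi]%R by rewrite in_itv /=; lra.
have C v : h <= v -> v <= 2 * pi - h -> cos v <= cos h.
  move=> hv v2; have [vp|vp] := leP v pi.
    by rewrite leNgt ltr_cos ?in_itv /= -?leNgt //; lra.
  have -> : cos v = cos (2 * pi - v).
    have -> : 2 * pi - v = - (v - pi) + pi by ring.
    by rewrite cosDpi cosN -cosDpi subrK.
  by rewrite leNgt ltr_cos ?in_itv /= -?leNgt //; lra.
have [hu|uh] := ltP (- h) u.
  have [u0|u0] := leP 0 u; first by rewrite ltr_cos ?in_itv //=; lra.
  by rewrite -[u]opprK cosN ltr_cos ?in_itv //=; lra.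
by apply/negbTE; rewrite -leNgt -[u]opprK cosN; apply: C; lra.
Qed.

Import HBSimple HBNNSimple.

(** * From rays to measurable sets and to square-integrable functions *)

Section FourierBasis.
Context {R : realType} {r : R} (r0 : 0 < r).
Notation D := (cball r).
Notation e := (@fourier R r).
Notation trig_approx := (@trig_approx R r).
Let preL := prehilbert_L2 r0.
Let mD := measurable_cball (r := r).
Let he := hin_fourier r0.

Lemma measurable_indic_cball (S : set (measurableTypeR R)) : measurable S ->
  measurable_fun D (\1_S : R -> R).
Proof. by move=> mS; apply: measurable_funTS; exact: measurable_indic. Qed.

Lemma trig_approx_indic_lim (f_ : nat -> R -> R) (S : set (measurableTypeR R)) :
  (forall n, trig_approx (f_ n)) -> measurable S ->
  (forall n t, -1 <= f_ n t <= 1) ->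
  (forall t, - (pi * r) < t < pi * r -> f_ n t @[n --> \oo] --> (\1_S t : R)) ->
  trig_approx \1_S.
Proof.
move=> tf mS f1 ff.
(* 4 = 2², as f_n lies in [-1, 1] and the indicator takes the values 0 and 1. *)
apply: (trig_approx_dominated r0 tf (measurable_indic_cball mS) ff (g := fun=> 4)).
  exact: integ_cst.
move=> n t _; have /andP[a b] := f1 n t.
have : 0 <= (2 - (f_ n t - \1_S t)) * (2 + (f_ n t - \1_S t)) :> R.
  by rewrite indicE; case: (t \in S); rewrite mulr_ge0 //=; lra.
have -> : (2 - (f_ n t - \1_S t)) * (2 + (f_ n t - \1_S t))
    = 4 - (f_ n t - \1_S t) ^+ 2 :> R by ring.
by rewrite subr_ge0.
Qed.

(* Inside [D] the ray is the arc on which cos ((t - m) / r) exceeds cos h. *)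
Lemma trig_approx_ray a : trig_approx \1_(`]a, +oo[%classic : set (measurableTypeR R)).
Proof.
have mS : measurable (`]a, +oo[%classic : set (measurableTypeR R)) by exact: measurable_itv.
have indE t : \1_(`]a, +oo[%classic : set (measurableTypeR R)) t = (a < t)%R%:R :> R.
  by rewrite indicE mem_setE in_itv /= andbT.
have c c' := trig_approx_poly r0 (trig_poly_cst c').
(* A ray that misses the interior of D, or contains it, agrees there with a constant. *)
have [pa|ap] := leP (pi * r) a.
  apply: (trig_approx_indic_lim (f_ := fun _ _ => 0) _ mS) => [n|n t|t /andP[_ t1]].
  - exact: c.
  - lra.
  - rewrite indE; have -> : (a < t) = false by apply/negbTE; rewrite -leNgt; lra.
    exact: cvg_cst.
have [pa|pa] := leP a (- (pi * r)).
  apply: (trig_approx_indic_lim (f_ := fun _ _ => 1) _ mS) => [n|n t|t /andP[t1 _]].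
  - exact: c.
  - lra.
  - rewrite indE; have -> : a < t by lra.
    exact: cvg_cst.
(* m is the midpoint of the interval from a to πr, and h is half its length measured as an angle. As
   t runs through the interior of D, (t - m)/r runs through exactly the period required by
   [cos_lt_arc]. *)
pose m := (a + pi * r) / 2; pose h := (pi * r - a) / (2 * r).
have hr : h * r = (pi * r - a) / 2 by rewrite /h; field; rewrite gt_eqF.
have h01 : 0 < h < pi.
  rewrite /h divr_gt0 ?mulr_gt0 //=; last by lra.
  by rewrite ltr_pdivrMr ?mulr_gt0 //; lra.
(* The factor 1/2 keeps q within [-1, 1], where the sign iteration converges. *)
pose q t := 1 / 2 * (cos ((t - m) / r) + - cos h).
have q1 t : -1 <= q t <= 1.
  have := cos_geN1 ((t - m) / r); have := cos_le1 ((t - m) / r).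
  have := cos_geN1 h; have := cos_le1 h; rewrite /q; lra.
apply: (trig_approx_indic_lim (f_ := fun n t => pos_approx n (q t)) _ mS) => [n|n t|t].
- apply: (trig_approx_poly r0); apply: trig_poly_pos_approx; apply: trig_polyM.
    exact: trig_poly_cst.
  by apply: trig_polyD; [exact: trig_poly_cos|exact: trig_poly_cst].
- by have := pos_approx_itv n (q1 t); lra.
- move=> /andP[t1 t2]; have := pos_approx_cvg (q1 t); rewrite indE.
  suff -> : (0 < q t) = (a < t) by [].
  have -> : (0 < q t) = (cos h < cos ((t - m) / r)).
    by rewrite /q pmulr_rgt0 ?subr_gt0.
  rewrite cos_lt_arc //; first by rewrite ltr_pdivlMr // mulNr hr /m; lra.
  rewrite ltr_pdivlMr // ltr_pdivrMr // hr mulNr mulrBl hr /m; lra.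
Qed.

(** Dynkin's π-λ argument: rays are stable under intersection and generate the Borel sets; a
    complement corresponds to 1 minus an indicator, and a disjoint union to the limit of partial
    sums, which stay between 0 and 1. *)
Lemma trig_approx_indic (S : set (measurableTypeR R)) : measurable S -> trig_approx \1_S.
Proof.
move=> mS.
apply: (@dynkin_induction _ (measurableTypeR R) (@RGenOInfty.G R)
  (fun S => trig_approx \1_S)) => //.
- exact: RGenOInfty.measurableE.
- move=> A B [x ->] [y ->]; exists (Num.max x y).
  by apply/seteqP; split => t /=; rewrite !in_itv /= !andbT gt_max; [move=> [-> ->]|move/andP].
- have := trig_approx_poly r0 (trig_poly_cst 1).
  by congr trig_approx; apply/funext => t; rewrite indicT.
- by move=> A [x ->]; exact: trig_approx_ray.
- move=> A mA tA; have := trig_approx_lin r0 (-1) tA (trig_approx_poly r0 (trig_poly_cst 1)).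
  congr trig_approx; apply/funext => t; rewrite !indicE in_setC.
  by case: (t \in A) => /=; ring.
- move=> F mF tF PF.
  have E (k : nat) t : F k t -> forall n,
      \sum_(i < n) 1 * \1_(F i) t = (k < n)%N%:R :> R.
    move=> Fkt n; have Z (i : 'I_n) : i != k :> nat -> 1 * \1_(F i) t = 0 :> R.
      move=> ik; rewrite indicE mul1r; case: (boolP (t \in F i)) => //; rewrite inE => Fit.
      by move: ik; rewrite (tF i k I I) ?eqxx //; exists t.
    case: ltnP => kn; last first.
      by rewrite big1 // => i _; apply: Z; rewrite ltn_eqF // (leq_trans _ kn).
    rewrite (bigD1 (Ordinal kn)) //= big1 ?addr0 => [|i ik]; last exact: Z.
    by rewrite indicE mem_set // mul1r.
  apply: (trig_approx_indic_lim (f_ := fun n t => \sum_(i < n) 1 * \1_(F i) t)).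
  + move=> n; have := trig_approx_sum r0 (index_enum 'I_n) (fun=> 1) (fun i => PF i).
    by [].
  + exact: bigcup_measurable.
  + move=> n t; have [[k Fkt]|nF] := pselect (exists k, F k t).
      by rewrite (E k t Fkt); case: ltnP => _ /=; lra.
    rewrite big1 => [|i _]; first lra.
    by rewrite indicE memNset ?mulr0 // => Fit; apply: nF; exists i.
  + move=> t _; have [[k Fkt]|nF] := pselect (exists k, F k t).
      rewrite (_ : \1_(\bigcup_k0 F k0) t = 1); last by rewrite indicE mem_set //; exists k.
      apply: cvg_near_cst; exists k.+1 => // n /= kn; by rewrite (E k t Fkt) kn.
    rewrite (_ : \1_(\bigcup_k0 F k0) t = 0).
      apply: cvg_near_cst; apply: nearW => n; rewrite big1 // => i _.
      by rewrite indicE memNset ?mulr0 // => Fit; apply: nF; exists i.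
    by rewrite indicE memNset // => -[k _ Fkt]; apply: nF; exists k.
- exact: (eq_ind _ (fun M : set (set R) => M S) mS _ (RGenOInfty.measurableE R)).
Qed.

(** Simple functions increasing to f are combinations of indicators, and their squared distance to f
    is dominated by f². *)
Lemma trig_approx_ge0 f : L2fun (r := r) f -> (forall t, D t -> 0 <= f t) -> trig_approx f.
Proof.
move=> [mf f2] f0.
have [g [gnd gf]] := approximation mD ((measurable_EFinP _ _).2 mf)
  (fun t Dt => (f0 t Dt : (0 <= (EFin \o f) t)%E)).
have gf' t : D t -> g n t @[n --> \oo] --> f t.
  by move=> Dt; have /fine_cvg := gf t Dt.
have Dint t : - (pi * r) < t < pi * r -> D t.
  by move=> /andP[t1 t2]; rewrite /cball /= in_itv /= !ltW.
apply: (@trig_approx_dominated _ _ r0 (fun n => g n : R -> R) f (fun t => f t ^+ 2)) => //.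
- move=> n; have H y : trig_approx \1_(g n @^-1` [set y]).
    by apply: trig_approx_indic; exact: measurable_sfunP.
  have := trig_approx_sum r0 (finmap.enum_fset (fset_set (range (g n)))) id H.
  congr trig_approx; apply/funext => t.
  by rewrite fimfunE fsbig_finite.
- by move=> t /Dint; exact: gf'.
- move=> n t Dt; have gn : g n t <= f t.
    have nd : {homo (fun n => g n t) : i j / (i <= j)%N >-> i <= j}.
      by move=> i j ij; have /lefP := gnd i j ij.
    rewrite -(cvg_lim _ (gf' t Dt)) //; apply: (nondecreasing_cvgn_le nd).
    by apply/cvg_ex; exists (f t); exact: gf'.
  have gn0 : 0 <= g n t by exact: fun_ge0.
  rewrite -sqrrN opprB ler_pXn2r ?nnegrE ?subr_ge0 ?f0 //.
  by rewrite gerBl.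
Qed.

Lemma trig_approx_L2fun f : L2fun (r := r) f -> trig_approx f.
Proof.
move=> Lf; have Ln : L2fun (r := r) (fun t => `|f t|).
  split; first by apply: measurableT_comp => //; exact: Lf.1.
  have := Lf.2; congr integ; apply/funext => t.
  by rewrite real_normK ?num_real.
have Ls : L2fun (r := r) (fun t => `|f t| + f t).
  by have := L2fun_lin 1 Ln Lf; congr L2fun; apply/funext => t; rewrite mul1r.
have := trig_approx_lin r0 (-1) (trig_approx_ge0 Ln (fun t _ => normr_ge0 _))
  (trig_approx_ge0 Ls (fun t _ => shift_ge0 f t)).
by congr trig_approx; apply/funext => t; ring.
Qed.

Lemma fourier_basis : orthonormal_basis e.
Proof.
apply: (closed_span_basis (fourier_orthonormal r0)) => x /hin_L2[xr xi].
have := in_closed_span_lin preL he 'i%C (trig_approx_L2fun xi) (trig_approx_L2fun xr).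
congr in_closed_span; apply/funext => t.
rewrite /cfct -[LHS]/('i%C * (Im (x t))%:C + (Re (x t))%:C).
by apply: complex_eqP; rewrite !ReImE /=; ring.
Qed.

End FourierBasis.

(** * The Dirac operator of a circle *)

Lemma nsum_int (R : realType) (a : int -> R) : (forall l, 0 <= a l) ->
  nsum a = (nsum (fun n : nat => a n) + nsum (fun n : nat => a (Negz n)))%E.
Proof.
move=> a0; rewrite /nsum (esumID (range Posz)) //; last by move=> l _; rewrite lee_fin.
have -> : [set: int] `&` range Posz = range Posz by rewrite setTI.
have -> : [set: int] `&` ~` range Posz = range Negz.
  rewrite setTI; apply/seteqP; split => [[n|n] /=|_ [n _ <-]].
  - by move=> []; exists n.
  - by move=> _; exists n.
  - by move=> [k].
congr (_ + _)%E; apply: reindex_esum; split => //.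
- by move=> n m _ _ [].
- by move=> n m _ _ [].
Qed.

Lemma rsum_abs_le (R : realType) (I : choiceType) (u : I -> R) : abs_summable u ->
  `|rsum u| <= fine (nsum (fun i => `|u i|)).
Proof.
move=> su; rewrite rsum_shift // ler_norml.
have n0 : forall i, 0 <= `|u i| by [].
have f1 := nsum_fin n0 su.
have f2 := nsum_fin (fun i => shift_ge0 u i) (abs_summable_shift su).
have : fine (nsum (fun i => `|u i| + u i)) <= 2 * fine (nsum (fun i => `|u i|)).
  rewrite -lee_fin EFinM !fineK // -nsumZ //.
  by apply: le_nsum => i; have := ler_norm (u i); lra.
have : 0 <= fine (nsum (fun i => `|u i| + u i)).
  by rewrite fine_ge0 // nsum_ge0 // => i; exact: shift_ge0.
have : 0 <= fine (nsum (fun i => `|u i|)) by rewrite fine_ge0 // nsum_ge0.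
lra.
Qed.

Section MeasurableSums.
Context {R : realType} (D : set (measurableTypeR R)).

Lemma measurable_nsum_nat (u : nat -> R -> R) : (forall n t, 0 <= u n t) ->
  (forall n, measurable_fun D (u n)) ->
  measurable_fun D (fun t => nsum (fun n => u n t)).
Proof.
move=> u0 mu.
rewrite (_ : (fun t => _) = fun t => (\sum_(0 <= n <oo | n \in xpredT) (u n t)%:E)%E).
  apply: ge0_emeasurable_sum => [n t _ _|n _]; first by rewrite lee_fin.
  exact/measurable_EFinP.
by apply/funext => t; rewrite /nsum -nneseries_esumT // => n; rewrite lee_fin.
Qed.

Lemma measurable_nsum_int (u : int -> R -> R) : (forall l t, 0 <= u l t) ->
  (forall l, measurable_fun D (u l)) ->
  measurable_fun D (fun t => nsum (fun l => u l t)).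
Proof.
move=> u0 mu; under eq_fun do rewrite nsum_int //.
by apply: emeasurable_funD; exact: measurable_nsum_nat.
Qed.

(** The shift decomposition of [rsum] reduces this to nonnegative series, and a sum over the
    integers is treated as two sums over the naturals. *)
Lemma measurable_rsum_int (u : int -> R -> R) : (forall l, measurable_fun D (u l)) ->
  (forall t, abs_summable (fun l => u l t)) ->
  measurable_fun D (fun t => rsum (fun l => u l t)).
Proof.
move=> mu su; rewrite (_ : (fun t => _) = fun t => fine (nsum (fun l => `|u l t| + u l t))
    - fine (nsum (fun l => `|u l t|))); last first.
  by apply/funext => t; rewrite rsum_shift.
have mn l : measurable_fun D (fun t => `|u l t|) by exact: measurableT_comp.
apply: measurable_funB; apply: (measurableT_comp (f := fine)) => //.
- apply: measurable_nsum_int => [l t|l]; first exact: (shift_ge0 (fun=> u l t) tt).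
  exact: measurable_funD.
- by apply: measurable_nsum_int.
Qed.

End MeasurableSums.

(** * The operator g(D) on one circle as a Fourier multiplier *)

Section FourierMultiplier.
Context {R : realType} {r : R} (r0 : 0 < r).
Notation D := (cball r).
Notation e := (@fourier R r).
Context (w : int -> R) (w0 : forall l, 0 <= w l) (W : R) (wW : (nsum w <= W%:E)%E).
Let preL := prehilbert_L2 r0.
Let he := hin_fourier r0.
Implicit Types (x y : L2 r).

(** Since the weights are summable and the Fourier coefficients bounded, the series converges
    absolutely at every point t, so a representative can be given directly instead of a limit in
    L². *)
Definition multiplier x : L2 r :=
  (fun t => csum (fun l => (w l)%:C * hdot x (e l) * e l t)) : R -> R[i].

Let W0 : 0 <= W.
Proof. by rewrite -lee_fin; apply: le_trans wW; exact: nsum_ge0. Qed.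

Lemma multiplier_term_le x l t : hin x ->
  `|Re ((w l)%:C * hdot x (e l) * e l t)| <= hnorm x * w l /\
  `|Im ((w l)%:C * hdot x (e l) * e l t)| <= hnorm x * w l.
Proof.
move=> hx; set z := _ * e l t.
have zw : nsq z <= (hnorm x * w l) ^+ 2.
  rewrite !nsqM nsq_fourier mulr1 nsqR exprMn mulrC ler_wpM2r ?sqr_ge0 //.
  have el : hnorm (e l) ^+ 2 = 1.
    by rewrite (sqr_hnorm preL (he l)) hdot_fourier // eqxx.
  by have := cauchy_schwarz preL hx (he l); rewrite el mulr1.
have xw : 0 <= hnorm x * w l by rewrite mulr_ge0 ?hnorm_ge0.
by split; rewrite -(@ler_pXn2r _ 2%N) ?nnegrE // -normrX ger0_norm ?sqr_ge0 //;
  apply: le_trans zw; rewrite ?sqr_Re_le ?sqr_Im_le.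
Qed.

Lemma nsum_multiplier_bound x :
  (nsum (fun l => (hnorm x * w l)%R) <= (hnorm x * W)%:E)%E.
Proof.
by rewrite nsumZ ?hnorm_ge0 // EFinM lee_wpmul2l // lee_fin hnorm_ge0.
Qed.

Lemma multiplier_csummable x t : hin x ->
  csummable (fun l => (w l)%:C * hdot x (e l) * e l t).
Proof.
move=> hx; have S := le_lt_trans (nsum_multiplier_bound x) (ltry _).
by split; apply: abs_summable_le S => l; have [] := multiplier_term_le l t hx.
Qed.

(** Real and imaginary part are each at most W‖x‖ in absolute value, and bounding both separately
    costs the factor 2. As the measure on the circle is normalised, this pointwise bound is also one
    for the norm. *)
Lemma multiplier_le x t : hin x -> nsq (multiplier x t) <= (2 * W * hnorm x) ^+ 2.
Proof.
move=> hx; have [sr si] := multiplier_csummable t hx.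
have B (u : int -> R) : abs_summable u -> (forall l, `|u l| <= hnorm x * w l) ->
    rsum u ^+ 2 <= (hnorm x * W) ^+ 2.
  move=> su uw; rewrite -(real_normK (num_real (rsum u))).
  rewrite ler_pXn2r ?nnegrE ?mulr_ge0 ?hnorm_ge0 //.
  apply: le_trans (rsum_abs_le su) _; rewrite -lee_fin fineK ?nsum_fin //.
  by apply: le_trans (nsum_multiplier_bound x); exact: le_nsum.
have Br := B _ sr (fun l => (multiplier_term_le l t hx).1).
have Bi := B _ si (fun l => (multiplier_term_le l t hx).2).
have -> : (2 * W * hnorm x) ^+ 2 = 4 * (hnorm x * W) ^+ 2 by ring.
have := sqr_ge0 (hnorm x * W); move: Br Bi; rewrite /nsq /multiplier /csum /=; lra.
Qed.

Lemma measurable_fourier_mul z l :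
  measurable_fun D (fun t => Re (z * e l t)) /\ measurable_fun D (fun t => Im (z * e l t)).
Proof.
have cr := @continuous_Re_fourier R r l; have ci := @continuous_Im_fourier R r l.
have mr := measurable_continuous (r := r) cr; have mi := measurable_continuous (r := r) ci.
split.
  rewrite (_ : (fun t => _) = fun t => Re z * Re (e l t) + (- Im z) * Im (e l t)).
    by apply: measurable_funD; exact: measurable_funM.
  by apply/funext => t; rewrite Re_mul mulNr.
rewrite (_ : (fun t => _) = fun t => Re z * Im (e l t) + Im z * Re (e l t)).
  by apply: measurable_funD; exact: measurable_funM.
by apply/funext => t; rewrite Im_mul.
Qed.

Lemma hin_multiplier x : hin x -> hin (multiplier x).
Proof.
move=> hx; apply: (hin_bounded r0 (M := (2 * W * hnorm x) ^+ 2)) => [||t _].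
- apply: (measurable_rsum_int (u := fun l t => Re _)) => [l|t].
    exact: (measurable_fourier_mul _ _).1.
  by have [] := multiplier_csummable t hx.
- apply: (measurable_rsum_int (u := fun l t => Im _)) => [l|t].
    exact: (measurable_fourier_mul _ _).2.
  by have [] := multiplier_csummable t hx.
- exact: multiplier_le.
Qed.

Lemma multiplier_bounded x : hin x -> hnorm (multiplier x) <= 2 * W * hnorm x.
Proof.
move=> hx; apply: (hnorm_bounded r0 (hin_multiplier hx)).
  by rewrite !mulr_ge0 ?hnorm_ge0.
by move=> t _; exact: multiplier_le.
Qed.

Lemma multiplier_lin a x y : hin x -> hin y ->
  multiplier (a *: x + y) = a *: multiplier x + multiplier y.
Proof.
move=> hx hy; apply/funext => t.
have sx := multiplier_csummable t hx; have sy := multiplier_csummable t hy.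
rewrite -[RHS]/(a * multiplier x t + multiplier y t) /multiplier -csumZ //.
rewrite -csumD //; last exact: csummableZ.
congr csum; apply/funext => l; rewrite (hdot_lin preL) //; ring.
Qed.

Lemma multiplier_fourier k : multiplier (e k) = (w k)%:C *: e k.
Proof.
apply/funext => t; rewrite /multiplier (@csum_supp1 _ _ k).
  by rewrite hdot_fourier // eqxx mulr1.
by move=> l lk; rewrite hdot_fourier // eq_sym (negPf lk) mulr0 mul0r.
Qed.

Lemma circle_eigensystem (c : R -> plane R) (g : R -> R) :
  (forall l : int, w l = g ((l%:~R + 1 / 2) / r)) ->
  eigensystem (curve_module r c) g (2 * W) W.
Proof.
move=> wg; apply: (@Eigensystem R (curve_module r c) g _ _ preL int (e : int -> L2 r)
  (fun l => (l%:~R + 1 / 2) / r) multiplier (fourier_basis r0)).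
- exact: circle_dirac0.
- by move=> l; exact: fourier_dirac.
- exact: hin_multiplier.
- by move=> a x y hx hy; rewrite multiplier_lin //; exact: (heq_refl preL).
- exact: multiplier_bounded.
- by move=> l; rewrite multiplier_fourier wg; exact: (heq_refl preL).
- by apply: le_trans wW; apply: le_nsum => l; rewrite wg.
Qed.

End FourierMultiplier.

(** * Growth of sequences and numerical sums *)

Section LimitSuperior.
Context {R : realType}.

Lemma limn_esup_inf (u : nat -> \bar R) : limn_esup u = ereal_inf (range (esups u)).
Proof. by rewrite limn_esup_lim; apply: cvg_lim => //; exact: cvg_esups_inf. Qed.

Lemma limn_esup_lt_eventually (u : nat -> \bar R) y : (limn_esup u < y)%E ->
  exists N, forall n, (N <= n)%N -> (u n < y)%E.
Proof.
rewrite limn_esup_inf => /ereal_inf_lt[_ [N _ <-] Ny]; exists N => n Nn.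
by apply: le_lt_trans Ny; apply: ereal_sup_ubound; exists n.
Qed.

Lemma limn_esup_le_eventually (u : nat -> \bar R) y N :
  (forall n, (N <= n)%N -> (u n <= y)%E) -> (limn_esup u <= y)%E.
Proof.
move=> uy; rewrite limn_esup_inf; apply: (@le_trans _ _ (esups u N)).
  by apply: ereal_inf_lbound; exists N.
by apply: ge_ereal_sup => _ [n Nn <-]; exact: uy.
Qed.

Lemma le_powR_inv (x y : R) m : 0 <= x -> 0 <= y ->
  (x `^ (m.+1%:R)^-1 <= y) = (x <= y ^+ m.+1).
Proof.
move=> x0 y0; have E : (x `^ (m.+1%:R)^-1) ^+ m.+1 = x.
  by rewrite -powR_mulrn ?powR_ge0 // -powRrM mulVf // powRr1.
by rewrite -[in RHS]E ler_pXn2r ?nnegrE ?powR_ge0.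
Qed.

Lemma root_growth_lt (F : nat -> R) (x y : R) : (forall m, 0 <= F m) -> 0 <= x < y ->
  (limn_esup (fun m => (F m `^ (m.+1%:R)^-1)%:E) <= x%:E)%E ->
  exists N, forall m, (N <= m)%N -> F m <= y ^+ m.+1.
Proof.
move=> F0 /andP[x0 xy] Fx.
have [N FN] := limn_esup_lt_eventually (le_lt_trans Fx (xy : x%:E < y%:E)%E).
exists N => m /FN; rewrite lte_fin => /ltW.
by rewrite le_powR_inv // (le_trans x0) // ltW.
Qed.

(** For x < y < z the constant B disappears after the (m+1)-st root because B (y/z)^m tends to 0. *)
Lemma root_growth_le (F : nat -> R) (x : R) : (forall m, 0 <= F m) -> 0 <= x ->
  (forall y, x < y -> exists B, forall m, F m <= B * y ^+ m) ->
  (limn_esup (fun m => (F m `^ (m.+1%:R)^-1)%:E) <= x%:E)%E.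
Proof.
move=> F0 x0 FB; apply/lee_addgt0Pr => eps eps0; rewrite -EFinD.
set z := x + eps; pose y := x + eps / 2.
have xy : x < y by rewrite /y; lra.
have y0 : 0 < y by lra.
have yz : y < z by rewrite /y /z; lra.
have z0 : 0 < z by lra.
have [B FBy] := FB y xy.
have : (B * (y / z) ^+ m) @[m --> \oo] --> B * 0.
  apply: cvgMl_tmp; apply: cvg_expr.
  by rewrite ger0_norm ?divr_ge0 1?ltW // ltr_pdivrMr // mul1r.
(* The threshold is z, not 1: the extra factor turns z^m into z^(m+1), the power belonging to the
   (m+1)-st root. *)
rewrite mulr0 => /cvgrPdist_lt /(_ z z0)[N _ HN].
apply: (@limn_esup_le_eventually _ _ N) => m Nm.
rewrite lee_fin le_powR_inv ?F0 ?(ltW z0) //; apply: le_trans (FBy m) _.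
have := HN m Nm; rewrite /= sub0r normrN => /ltW.
move=> /(le_trans (ler_norm _)); rewrite expr_div_n mulrA ler_pdivrMr ?exprn_gt0 //.
by rewrite -exprS.
Qed.

End LimitSuperior.

Section NumericalSums.
Context {R : realType}.

Lemma nsum_nat_le (u : nat -> R) B : (forall n, 0 <= u n) ->
  (forall N, \sum_(n < N) u n <= B) -> (nsum u <= B%:E)%E.
Proof.
move=> u0 uB; rewrite /nsum -nneseries_esumT; last by move=> n; rewrite lee_fin.
apply: lime_le; first by apply: is_cvg_nneseries => n _ _; rewrite lee_fin.
by apply: nearW => N; rewrite big_mkord sumEFin lee_fin.
Qed.

Lemma nsum_geometric (A x : R) : 0 <= A -> 0 <= x < 1 ->
  (nsum (fun n : nat => A * x ^+ n)%R < +oo)%E.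
Proof.
move=> A0 /andP[x0 x1]; apply: le_lt_trans (ltry (A * (1 - x)^-1)).
apply: nsum_nat_le => [n|N]; first by rewrite mulr_ge0 ?exprn_ge0.
rewrite -mulr_sumr ler_wpM2l // -[_^-1]mul1r ler_pdivlMr ?subr_gt0 //.
have -> : (\sum_(n < N) x ^+ n) * (1 - x) = 1 - x ^+ N.
  elim: N => [|N IH]; first by rewrite big_ord0 mul0r expr0 subrr.
  by rewrite big_ord_recr /= mulrDl IH exprS; ring.
by rewrite gerBl exprn_ge0.
Qed.

(** Comparison with the integral of x^(-3/2) in telescoping form: after the first term, which is 1,
    the term at n is at most 2/√(n-1) - 2/√n. This adds up to at most 1 + 2. *)
Lemma sum_inv_mul_sqrt_le (N : nat) :
  \sum_(n < N) (n.+1%:R * Num.sqrt n.+1%:R)^-1 <= 3 :> R.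
Proof.
case: N => [|N]; first by rewrite big_ord0.
suff : \sum_(n < N.+1) (n.+1%:R * Num.sqrt n.+1%:R)^-1 <= 3 - 2 / Num.sqrt N.+1%:R :> R.
  move/le_trans; apply; rewrite gerBl divr_ge0 // sqrtr_ge0.
elim: N => [|N IH]; first by rewrite big_ord_recr big_ord0 /= sqrtr1; lra.
rewrite big_ord_recr /=.
set a : R := Num.sqrt N.+1%:R in IH *; set c : R := Num.sqrt N.+2%:R.
have a0 : 0 < a by rewrite sqrtr_gt0.
have ac : a < c by rewrite ltr_sqrt ?ltr_nat.
have c0 : 0 < c by lra.
have c2 : N.+2%:R = c ^+ 2 :> R by rewrite sqr_sqrtr.
have a2 : a ^+ 2 = c ^+ 2 - 1 by rewrite !sqr_sqrtr // -[in RHS]natr1 addrK.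
have ca : c - a = (c + a)^-1.
  apply: (mulIf (lt0r_neq0 (addr_gt0 c0 a0))); rewrite mulVf ?gt_eqF ?addr_gt0 //.
  have -> : (c - a) * (c + a) = c ^+ 2 - a ^+ 2 by ring.
  by rewrite a2; ring.
have key : (N.+2%:R * c)^-1 <= 2 / a - 2 / c.
  have -> : 2 / a - 2 / c = 2 * ((c - a) / (a * c)) by field; rewrite !gt_eqF.
  have -> : (N.+2%:R * c)^-1 = 2 * (2 * (c ^+ 2 * c))^-1.
    by rewrite c2; field; rewrite gt_eqF.
  have p0 : 0 < (c + a) * (a * c) by rewrite !mulr_gt0 ?addr_gt0.
  rewrite ca -invfM ler_pM2l // lef_pV2 ?posrE ?p0 ?mulr_gt0 ?exprn_gt0 //.
  have -> : 2 * (c ^+ 2 * c) = (2 * c) * (c * c) by ring.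
  by apply: ler_pM; rewrite ?ler_wpM2r ?mulr_ge0 ?addr_ge0 ?ltW //; lra.
by apply: le_trans (lerD IH key) _; rewrite addrA subrK.
Qed.

End NumericalSums.

(** * The modules of the Sierpinski gasket *)

Section DiracTrace.
Context {R : realType} (p : R).
Hypothesis p32 : 3 / 2 <= p.
Notation g := (fun l : R => (1 + l ^+ 2) `^ (- (p / 2))).

(** Drop the 1 in 1 + mu² and use |mu| = (2n + 1)/(2r) >= (n + 1)/(2r); then (n + 1)^p is at least
    (n + 1)^(3/2). The hypothesis concerns mu² so as to cover both l = n and l = -(n + 1), for which
    l + 1/2 is n + 1/2 up to sign. *)
Lemma dirac_weight_le (r mu : R) (n : nat) : 0 < r ->
  mu ^+ 2 = ((n%:R + 1 / 2) / r) ^+ 2 ->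
  g mu <= (2 * r) `^ p * (n.+1%:R * Num.sqrt n.+1%:R)^-1.
Proof.
move=> r0 muE; set x := (n%:R + 1 / 2) / r in muE.
have n0 : 0 <= n%:R :> R by [].
have x0 : 0 < x by rewrite divr_gt0 // ltr_wpDl // divr_gt0.
have p0 : 0 <= p by apply: le_trans p32; rewrite divr_ge0.
have xp : x `^ p <= (1 + mu ^+ 2) `^ (p / 2).
  have -> : x `^ p = (x ^+ 2) `^ (p / 2).
    by rewrite -powR_mulrn ?(ltW x0) // -powRrM; congr (_ `^ _); field.
  rewrite muE; apply: ge0_ler_powR; rewrite ?nnegrE ?sqr_ge0 ?addr_ge0 ?sqr_ge0 ?divr_ge0 //.
  by rewrite lerDr.
rewrite powRN; apply: (@le_trans _ _ (x `^ p)^-1).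
  by rewrite lef_pV2 ?posrE ?powR_gt0 // ltr_wpDr ?sqr_ge0.
have r20 : 0 < 2 * r by rewrite mulr_gt0.
have -> : (x `^ p)^-1 = (2 * r) `^ p * ((2 * r * x) `^ p)^-1.
  rewrite (powRM p (ltW r20) (ltW x0)).
  by rewrite invfM mulrA divff ?mul1r // gt_eqF // powR_gt0.
have rx0 : 0 < 2 * r * x by exact: mulr_gt0.
have ns0 : 0 < n.+1%:R * Num.sqrt n.+1%:R :> R by rewrite mulr_gt0 ?sqrtr_gt0.
rewrite ler_wpM2l ?powR_ge0 // lef_pV2 ?posrE ?(powR_gt0 _ rx0) //.
have -> : n.+1%:R * Num.sqrt n.+1%:R = n.+1%:R `^ (3 / 2) :> R.
  have -> : 3 / 2 = 1 + 2^-1 :> R by field.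
  by rewrite powRD ?powRr1 ?powR12_sqrt // pnatr_eq0 implybT.
have n1 : 1 <= n.+1%:R :> R by rewrite ler1n.
apply: le_trans (ler_powR n1 p32) _.
apply: ge0_ler_powR; rewrite ?nnegrE ?(ltW rx0) //.
have -> : 2 * r * x = 2 * n%:R + 1 by rewrite /x; field; rewrite gt_eqF.
by rewrite -natr1; lra.
Qed.

Lemma dirac_trace_le (r : R) : 0 < r ->
  (nsum (fun l : int => g ((l%:~R + 1 / 2) / r)%R) <= (6 * (2 * r) `^ p)%:E)%E.
Proof.
move=> r0; have c0 : 0 <= (2 * r) `^ p by exact: powR_ge0.
have H (h : nat -> int) :
    (forall n, (((h n)%:~R + 1 / 2) / r) ^+ 2 = ((n%:R + 1 / 2) / r) ^+ 2 :> R) ->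
    (nsum (fun n => g (((h n)%:~R + 1 / 2) / r)%R) <= (3 * (2 * r) `^ p)%:E)%E.
  move=> hE; apply: nsum_nat_le => [n|N]; first exact: powR_ge0.
  apply: (@le_trans _ _ (\sum_(n < N) (2 * r) `^ p * (n.+1%:R * Num.sqrt n.+1%:R)^-1)).
    by apply: ler_sum => n _; apply: dirac_weight_le.
  by rewrite -mulr_sumr mulrC ler_wpM2r // sum_inv_mul_sqrt_le.
rewrite nsum_int; last by move=> l; exact: powR_ge0.
have -> : 6 * (2 * r) `^ p = 3 * (2 * r) `^ p + 3 * (2 * r) `^ p by ring.
rewrite EFinD; apply: leeD; apply: (H) => n //.
by rewrite NegzE mulrNz -natr1 -sqrrN; congr (_ ^+ 2); rewrite -pmulrn -natr1; field; rewrite gt_eqF.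
Qed.

Lemma circle_module_eigensystem (r : R) (c : R -> plane R) : 0 < r ->
  eigensystem (curve_module r c) g (2 * (6 * (2 * r) `^ p)) (6 * (2 * r) `^ p).
Proof.
move=> r0; apply: (circle_eigensystem r0 _ (dirac_trace_le r0)) => //.
by move=> l; exact: powR_ge0.
Qed.

Lemma eigensystem_weaken (M : ufmodule R) (f : R -> R) C C' t :
  C <= C' -> eigensystem M f C t -> eigensystem M f C' t.
Proof.
move=> CC [preM J b lam T bb D0 Db hT lT bT Tb tr].
apply: (@Eigensystem _ M f C' t preM J b lam T) => // x hx.
by apply: le_trans (bT x hx) _; rewrite ler_wpM2r // hnorm_ge0.
Qed.

(** The operator bound no longer depends on r, as direct sums over infinitely many circles require,
    while the trace bound keeps its decay in r. *)
Lemma small_circle_eigensystem (r : R) (c : R -> plane R) : 0 < r <= 1 ->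
  eigensystem (curve_module r c) g (12 * 2 `^ p) (6 * (2 * r) `^ p).
Proof.
move=> /andP[r0 r1]; apply: eigensystem_weaken (circle_module_eigensystem c r0).
have -> : 2 * (6 * (2 * r) `^ p) = 12 * (2 * r) `^ p by ring.
have p0 : 0 <= p by apply: le_trans p32; rewrite divr_ge0.
rewrite ler_pM2l //; apply: ge0_ler_powR; rewrite ?nnegrE ?mulr_ge0 ?(ltW r0) //.
by rewrite ler_piMr.
Qed.

End DiracTrace.

Section SummationOverTriangles.
Context {R : realType}.

Lemma nsum_finType (T : finType) (u : T -> R) : (forall i, 0 <= u i) ->
  nsum u = (\sum_i u i)%:E.
Proof.
have fT : finite_set [set: T] by exact: finite_finset.
move=> u0; rewrite /nsum esum_fset //; last by move=> i _; rewrite lee_fin.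
rewrite -sumEFin fsbig_finite //=; apply: perm_big.
apply: uniq_perm; rewrite ?finmap.fset_uniq ?index_enum_uniq // => i.
by rewrite mem_index_enum in_fset_set // mem_set.
Qed.

Lemma nsum_copies (n : HSG -> nat) (a : nat -> R) : (forall m, 0 <= a m) ->
  nsum (fun c : {h : HSG & 'I_(n h)} => a (tag (tag c)))
  = nsum (fun m => (\sum_(k < 3 ^ m) (n (hsg k))%:R) * a m).
Proof.
move=> a0; rewrite nsum_sigT; last by move=> c.
rewrite (_ : esum _ _ = nsum (fun h : HSG => (n h)%:R * a (tag h))); last first.
  apply: eq_esum => h _; rewrite nsum_finType //=.
  by rewrite sumr_const card_ord mulr_natl.
rewrite nsum_sigT; last by move=> h; rewrite mulr_ge0.
apply: eq_esum => m _; rewrite nsum_finType; last by move=> k; rewrite mulr_ge0.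
by rewrite mulr_suml.
Qed.

End SummationOverTriangles.

Section Exponents.
Context {R : realType} (p : R).
Hypothesis hp : ln 3 / ln 2 < p.

Lemma ln2_gt0 : 0 < ln 2 :> R.
Proof. by rewrite ln_gt0 // ltr1n. Qed.

Lemma three_lt_two_powR : 3 < 2 `^ p.
Proof.
rewrite -ltr_ln ?posrE ?powR_gt0 // ln_powR.
by move: hp; rewrite ltr_pdivrMr // ln2_gt0.
Qed.

Lemma three_halves_lt : 3 / 2 <= p.
Proof.
apply: ltW; apply: lt_trans hp; rewrite ltr_pdivlMr ?ln2_gt0 //.
have : ln (2 ^+ 3) < ln (3 ^+ 2) :> R by rewrite ltr_ln ?posrE ?exprn_gt0 // -!natrX ltr_nat.
rewrite !lnXn // -[ln 2 *+ 3]mulr_natl -[ln 3 *+ 2]mulr_natl; lra.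
Qed.

(** Triangles with index m have radius 2^(-(m+1)), so the trace bounds decay geometrically with
    ratio 2^(-p). *)
Lemma powR_half_pow m : (2 * (2 ^- m.+1)) `^ p = (2 `^ p)^-1 ^+ m :> R.
Proof.
have -> : 2 * 2 ^- m.+1 = 2 ^- m :> R by rewrite exprS invfM mulrA divff ?mul1r.
have -> : 2 ^- m = 2 `^ (- m%:R) :> R by rewrite powRN powR_mulrn.
by rewrite exprVn -powR_mulrn ?powR_ge0 // -!powRrM -powRN; congr (_ `^ _); ring.
Qed.

End Exponents.

Lemma nsum_growth (R : realType) (F : nat -> R) (y z c : R) : (forall m, 0 <= F m) ->
  0 < y -> 0 <= z -> y * z < 1 -> 0 <= c ->
  (exists N, forall m, (N <= m)%N -> F m <= y ^+ m.+1) ->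
  (nsum (fun m => (F m * (c * z ^+ m))%R) < +oo)%E.
Proof.
(* The summand y absorbs the exponent m + 1 beyond N, and the finite sum covers the indices below
   N. *)
move=> F0 y0 z0 yz c0 [N FN]; pose A := y + \sum_(j < N) F j / y ^+ j.
have s0 (P : pred 'I_N) : 0 <= \sum_(j < N | P j) F j / y ^+ j.
  by apply: sumr_ge0 => j _; rewrite divr_ge0 // exprn_ge0 // ltW.
have A0 : 0 <= A by rewrite addr_ge0 // ltW.
have FA m : F m <= A * y ^+ m.
  have ym : 0 <= y ^+ m by rewrite exprn_ge0 // ltW.
  have [Nm|mN] := leqP N m.
    by apply: le_trans (FN m Nm) _; rewrite exprS ler_wpM2r // lerDl.
  rewrite -ler_pdivrMr ?exprn_gt0 // /A (bigD1 (Ordinal mN)) //= addrCA lerDl.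
  by rewrite addr_ge0 // ltW.
apply: le_lt_trans (@nsum_geometric R (c * A) (y * z) _ _); last 2 first.
- by rewrite mulr_ge0.
- by rewrite mulr_ge0 // ltW.
apply: le_nsum => m; rewrite exprMn.
have -> : c * A * (y ^+ m * z ^+ m) = (A * y ^+ m) * (c * z ^+ m) by ring.
by rewrite ler_wpM2r // mulr_ge0 // exprn_ge0.
Qed.

Lemma eigensystem_dirsum2 (R : realType) (M N : ufmodule R) (g : R -> R) (C s t : R) :
  (forall l, 0 <= g l) -> 0 <= C -> 0 <= s -> 0 <= t ->
  eigensystem M g C s -> eigensystem N g C t ->
  eigensystem (dirsum2 M N) g C (fine (nsum (fun b : bool => if b then s else t))).
Proof.
move=> g0 C0 s0 t0 EM EN; have st (b : bool) : 0 <= if b then s else t by case: b.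
apply: eigensystem_dirsum => //; last by case.
by rewrite nsum_finType // ltry.
Qed.

(** * The two implications between growth and summability *)

Section SierpinskiSummability.
Context {R : realType} (f : HSG -> int).
Notation F := (fun m : nat => \sum_(k < 3 ^ m) (absz (f (hsg k)))%:R : R).

Lemma copies_ge0 m : 0 <= F m.
Proof. exact: sumr_ge0. Qed.

Lemma radius_nabla_gt0 h : 0 < radius (nabla R h).
Proof. by rewrite invr_gt0 exprn_gt0. Qed.

Lemma radius_nabla_le1 h : radius (nabla R h) <= 1.
Proof. by rewrite invf_le1 ?exprn_gt0 // exprn_ege1 // ler1n. Qed.

Lemma ST_summable (p : R) : ln 3 / ln 2 < p ->
  (limn_esup (fun m => (F m `^ (m.+1%:R)^-1)%:E) <= 3%:E)%E -> summable_for (ST R f) p.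
Proof.
move=> hp lim; have p32 := three_halves_lt hp; have p3 := three_lt_two_powR hp.
(* Any y strictly between 3 and 2^p would serve: above 3 the growth hypothesis applies, and below
   2^p the series of (y z)^m converges. *)
pose y := (3 + 2 `^ p) / 2; set z := (2 `^ p)^-1.
have w0 : 0 < 2 `^ p by exact: powR_gt0.
have z0 : 0 <= z by rewrite invr_ge0 ltW.
have y3 : 3 < y by rewrite /y; lra.
have yz : y * z < 1 by rewrite ltr_pdivrMr // mul1r /y; lra.
have z3 : 3 * z < 1 by rewrite ltr_pdivrMr // mul1r.
have growth : exists N, forall m, (N <= m)%N -> F m <= y ^+ m.+1.
  by apply: root_growth_lt lim => //; [exact: copies_ge0|lra].
pose g l := (1 + l ^+ 2) `^ (- (p / 2)) : R.
have g0 l : 0 <= g l by exact: powR_ge0.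
pose C := 12 * 2 `^ p; have C0 : 0 <= C by rewrite mulr_ge0 // ltW.
pose a m : R := 6 * z ^+ m; have a0 m : 0 <= a m by rewrite mulr_ge0 // exprn_ge0.
have aE h : a (tag h) = 6 * (2 * radius (nabla R h)) `^ p by rewrite /a /z -powR_half_pow.
have Eh h (c : R -> plane R) : eigensystem (curve_module (radius (nabla R h)) c) g C (a (tag h)).
  by rewrite aE; apply: small_circle_eigensystem; rewrite ?radius_nabla_gt0 ?radius_nabla_le1.
have S1 : (nsum (fun h : HSG => a (tag h)) < +oo)%E.
  rewrite nsum_sigT //; apply: le_lt_trans (@nsum_geometric R 6 (3 * z) _ _) => //.
    apply: le_esum => m _; rewrite nsum_finType //= sumr_const card_ord lee_fin.
    by rewrite /a -[_ *+ (3 ^ m)]mulr_natl natrX exprMn; rewrite le_eqVlt; apply/orP; left; apply/eqP; ring.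
  by rewrite mulr_ge0.
have S2 : (nsum (fun c : {h : HSG & 'I_(absz (f h))} => a (tag (tag c))) < +oo)%E.
  rewrite (nsum_copies (fun h => absz (f h)) a0).
  by apply: (nsum_growth copies_ge0 _ z0 yz) => //; lra.
have E1 := eigensystem_dirsum g0 C0 (fun h : HSG => a0 (tag h)) S1 (fun h => Eh h (rho (nabla R h))).
have E2 : eigensystem (UFM_mult R f) g C (fine (nsum (fun c : {h : HSG & 'I_(absz (f h))} => a (tag (tag c))))).
  apply: eigensystem_dirsum => // c; case: ifP => _; exact: Eh.
have E0 : eigensystem (UFM_bar (Delta01 R)) g C (6 * (2 * 1) `^ p).
  by apply: small_circle_eigensystem; rewrite ?ltr01 ?lexx.
have n0 (I : choiceType) (u : I -> R) : (forall i, 0 <= u i) -> 0 <= fine (nsum u).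
  by move=> u0; rewrite fine_ge0 // nsum_ge0.
have t0 : 0 <= 6 * (2 * 1) `^ p by rewrite mulr_ge0 ?powR_ge0.
have E3 := eigensystem_dirsum2 g0 C0 t0 (n0 _ _ (fun h => a0 _)) E0 E1.
have E4 := eigensystem_dirsum2 g0 C0 _ _ E3 E2.
apply: eigensystem_summable (E4 _ _).
  by apply: (n0 _ _ _) => -[]; [exact: t0|exact: (n0 _ _ _)].
by apply: (n0 _ _ _).
Qed.

Lemma prehilbert_ST : prehilbert (ST R f).
Proof.
have P h c : prehilbert (curve_module (radius (nabla R h)) c).
  exact: (prehilbert_L2 (radius_nabla_gt0 h)).
apply: prehilbert_hsum => -[]; apply: prehilbert_hsum.
  by case; [exact: (prehilbert_L2 ltr01)|apply: prehilbert_hsum => h; exact: P].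
by move=> c; case: ifP => _; exact: P.
Qed.

(** Each copy at index m contributes the constant function as a weak eigenvector, and vectors from
    different copies are orthogonal. The sum of the corresponding weights over all copies is
    therefore finite, and its part at index m is bounded by the whole. *)
Lemma ST_unsummable (p : R) : summable_for (ST R f) p ->
  exists B, forall m, F m * (1 + (2 ^+ m) ^+ 2) `^ (- (p / 2)) <= B.
Proof.
move=> sp.
pose N (c : {h : HSG & 'I_(absz (f h))}) : ufmodule R :=
  if 0 < f (tag c) then UFM (nabla R (tag c)) else UFM_bar (nabla R (tag c)).
have preN c : prehilbert (N c).
  by rewrite /N; case: ifP => _; exact: (prehilbert_L2 (radius_nabla_gt0 _)).
have vE c : exists v : N c,
    weak_eigenvector (2 ^+ tag (tag c)) v /\ hdot v v = 1.
  have r0 := radius_nabla_gt0 (tag c).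
  (* The frequency 0 gives the eigenvalue 1/(2r), and r = 2^(-(m+1)). *)
  have -> : 2 ^+ tag (tag c) = (0%:~R + 1 / 2) / radius (nabla R (tag c)) :> R.
    by rewrite /= invrK exprS; field.
  rewrite /N; case: ifP => _; exists (fourier _ 0); split;
    by [exact: fourier_weak_eigenvector|rewrite hdot_fourier].
pose v c := sval (cid (vE c)).
have hv c : hin (v c) by exact: (svalP (cid (vE c))).1.1.
pose M (b : bool) : ufmodule R := if b then ZGT R else UFM_mult R f.
have preM b : prehilbert (M b).
  by case: b; [apply: prehilbert_hsum; case; [exact: (prehilbert_L2 ltr01)|
    apply: prehilbert_hsum => h; exact: (prehilbert_L2 (radius_nabla_gt0 h))]
    |exact: (prehilbert_hsum preN)].
pose u c : M false := emb (H := fun c => hspace (N c)) (v c).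
have hu c : hin (u c) by exact: (hin_emb preN).
pose e c : ST R f := emb (H := fun b => hspace (M b)) (u c).
have oe : orthonormal e.
  split=> [c|c c']; first exact: (hin_emb preM).
  rewrite /e (hdot_emb preM (hin_emb preM (hu c)) (hu c')) emb_in.
  rewrite (hdot_emb preN (hu c) (hv c')) /u; have [<-|cc'] := eqVneq c c'.
    by rewrite emb_in; exact: (svalP (cid (vE c))).2.
  by rewrite emb_out 1?eq_sym // (hdot0l (preN c')).
have eE c : weak_eigenvector (2 ^+ tag (tag c)) (e c).
  apply: (weak_eigenvector_emb preM); apply: (weak_eigenvector_emb preN).
  exact: (svalP (cid (vE c))).1.
have := summable_for_eigenvalues prehilbert_ST oe eE sp.
pose a (m : nat) : R := (1 + (2 ^+ m) ^+ 2) `^ (- (p / 2)).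
have a0 m : 0 <= a m by exact: powR_ge0.
rewrite (nsum_copies (fun h => absz (f h)) a0) => S.
have Fa0 m : 0 <= F m * a m by rewrite mulr_ge0 ?copies_ge0.
exists (fine (nsum (fun m => F m * a m))) => m; rewrite -lee_fin fineK ?nsum_fin //.
apply: esum_ge; exists [set m]; first by split => //; exact: finite_set1.
by rewrite fsbig_set1.
Qed.

(** Given y > 3, the exponent p = log y / log 2 is admissible and turns 2^p into y, so boundedness
    of the weighted counts becomes growth of order y^m. *)
Lemma ST_growth : (forall p : R, ln 3 / ln 2 < p -> summable_for (ST R f) p) ->
  (limn_esup (fun m => (F m `^ (m.+1%:R)^-1)%:E) <= 3%:E)%E.
Proof.
move=> sp; apply: root_growth_le => // [|y y3]; first exact: copies_ge0.
have l2 := @ln2_gt0 R; have y0 : 0 < y by lra.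
pose p := ln y / ln 2; have hp : ln 3 / ln 2 < p.
  by rewrite ltr_pM2r ?invr_gt0 // ltr_ln ?posrE.
have p0 : 0 < p.
  by apply: lt_trans hp; rewrite divr_gt0 // ln_gt0 // ltr1n.
have yE : 2 `^ p = y.
  rewrite /powR pnatr_eq0 /= /p divfK ?gt_eqF // lnK // posrE //.
have [B HB] := ST_unsummable (sp p hp).
(* The factor 2^(p/2) comes from 1 + 4^m <= 2 · 4^m. *)
exists (B * 2 `^ (p / 2)) => m.
have m2 : 0 < 2 ^+ m :> R by rewrite exprn_gt0.
have yp : 2 `^ (p / 2) * y ^+ m = (2 * (2 ^+ m) ^+ 2) `^ (p / 2).
  rewrite powRM ?sqr_ge0 // -yE; congr (_ * _).
  have -> : (2 `^ p) ^+ m = 2 `^ (p * m%:R) by rewrite -powR_mulrn ?powR_ge0 // powRrM.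
  have -> : (2 ^+ m) ^+ 2 = 2 `^ (m%:R * 2) :> R by rewrite -exprM -powR_mulrn // natrM.
  by rewrite -powRrM; congr (_ `^ _); field.
have W0 : 0 < (1 + (2 ^+ m) ^+ 2) `^ (p / 2) :> R.
  by rewrite powR_gt0 // addr_gt0 // exprn_gt0.
have := HB m; rewrite powRN ler_pdivrMr // => /le_trans; apply.
have B0 : 0 <= B.
  by apply: le_trans (HB m); rewrite mulr_ge0 ?copies_ge0 // powR_ge0.
rewrite -mulrA yp ler_wpM2l //; apply: ge0_ler_powR.
- by rewrite divr_ge0 // ltW.
- by rewrite nnegrE addr_ge0 // sqr_ge0.
- by rewrite nnegrE mulr_ge0 // sqr_ge0.
- have : 1 <= (2 ^+ m) ^+ 2 :> R by rewrite !exprn_ege1 // ler1n.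
  lra.
Qed.

End SierpinskiSummability.

Theorem theorem3p7 (R : realType) (f : HSG -> int) :
  (forall p : R, ln 3 / ln 2 < p -> summable_for (ST R f) p)
  <->
  (limn_esup (fun m : nat =>
     ((\sum_(k < 3 ^ m) (absz (f (hsg k)))%:R : R)
        `^ (m.+1%:R)^-1)%:E) <= 3%:E)%E.
Proof.
split; first exact: ST_growth.
by move=> lim p hp; exact: ST_summable.
Qed.
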